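(* Let $k\ge 1$, let $m_1,\ldots,m_k$ be nonnegative integers, let $Q_{m_1},\ldots,Q_{m_k}$ be nonzero polynomials with integer coefficients with $\deg Q_{m_i}\le m_i$, let $\alpha_1,\ldots,\alpha_k>0$, and let $$w(x)=\prod_{i=1}^k |Q_{m_i}(x)|^{\alpha_i},\qquad x\in[0,1].$$ Put $\alpha:=\sum_{i=1}^k \alpha_i m_i$ and $c_w:=\mathrm{cap}([0,1],w)$. Then $$\int_1^x \psi(t)\,dt \;\ge\; \frac{-2\log c_w}{4\alpha+3}\,\frac{x^2}{2} + O(x\log^2 x)\qquad\text{as } x\to+\infty.$$
   Context: $\psi(x):=\sum_{p^m\le x}\log p$ is the Chebyshev function (sum over prime powers $p^m\le x$, $p$ prime, $m\ge1$). For a compact interval $[a,b]\subset\mathbb R$ and a nonnegative weight $w$ on $[a,b]$ (not identically zero), let $\mathcal M([a,b])$ be the set of positive unit Borel measures supported on $[a,b]$, define the weighted energy $I_w(\mu):=\iint \log\frac{1}{|z-t|\,w(z)\,w(t)}\,d\mu(z)\,d\mu(t)$, $V_w:=\inf_{\mu\in\mathcal M([a,b])} I_w(\mu)$, and the weighted capacity $\mathrm{cap}([a,b],w):=e^{-V_w}$. *)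

(* Defs.v *)
From Stdlib Require Import Reals Lra ZArith Znumtheory List ClassicalEpsilon Classical.
Import ListNotations.
Open Scope R_scope.

(* psi x = sum over prime powers p^m <= x (p prime, m >= 1) of log p.
   Any such p, m satisfy p, m <= p^m <= x < up x, so the ranges below suffice. *)
Definition psi (x : R) : R :=
  let N := Z.to_nat (up x) in
  fold_right Rplus 0
    (map (fun p =>
       fold_right Rplus 0
         (map (fun m =>
            if prime_dec (Z.of_nat p) then
              (if Rle_dec (INR p ^ m) x then ln (INR p) else 0)
            else 0) (seq 1 N)))
     (seq 0 (S N))).

Definition peval (c : list Z) (x : R) : R :=
  fold_right (fun a acc => IZR a + x * acc) 0 c.

Definition poly_nonzero (c : list Z) : Prop := exists a, In a c /\ a <> 0%Z.

Definition poly_deg_le (c : list Z) (m : nat) : Prop := (length c <= S m)%nat.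

(* b^a for b >= 0, a > 0, with 0^a = 0 *)
Definition rpow (b a : R) : R :=
  if Req_EM_T b 0 then 0 else Rpower b a.

(* ---------- extended reals (-oo excluded): None = +oo ---------- *)
Definition ext := option R.

Definition ext_le (r : R) (v : ext) : Prop :=
  match v with None => True | Some y => r <= y end.

Definition sigma_algebra (S : (R -> Prop) -> Prop) : Prop :=
  S (fun _ => True) /\
  (forall A, S A -> S (fun x => ~ A x)) /\
  (forall F : nat -> R -> Prop, (forall n, S (F n)) -> S (fun x => exists n, F n x)).

Definition borel (A : R -> Prop) : Prop :=
  forall S, sigma_algebra S -> (forall a b, S (fun x => a < x < b)) -> S A.

(* mu is a positive unit Borel measure supported on [a,b]
   (its values on non-Borel sets are irrelevant). *)
Definition unit_measure_on (a b : R) (mu : (R -> Prop) -> R) : Prop :=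
  (forall A, borel A -> 0 <= mu A) /\
  mu (fun _ => True) = 1 /\
  (forall F : nat -> R -> Prop,
      (forall n, borel (F n)) ->
      (forall n p x, n <> p -> F n x -> F p x -> False) ->
      infinite_sum (fun n => mu (F n)) (mu (fun x => exists n, F n x))) /\
  mu (fun x => ~ (a <= x <= b)) = 0.

Definition simple_ok (l : list (R * (R -> Prop))) : Prop :=
  Forall (fun p => 0 <= fst p /\ borel (snd p)) l.

Definition simple_val (l : list (R * (R -> Prop))) (x : R) : R :=
  fold_right (fun p acc =>
     (if excluded_middle_informative (snd p x) then fst p else 0) + acc) 0 l.

Definition simple_int (mu : (R -> Prop) -> R) (l : list (R * (R -> Prop))) : R :=
  fold_right (fun p acc => fst p * mu (snd p) + acc) 0 l.

(* values of integrals of simple functions below g (0 included explicitly;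
   g is always nonnegative where this is used, so this changes nothing) *)
Definition lint_set (mu : (R -> Prop) -> R) (g : R -> ext) (r : R) : Prop :=
  r = 0 \/ exists l, simple_ok l /\ (forall x, ext_le (simple_val l x) (g x)) /\
            r = simple_int mu l.

Definition sup_ext (E : R -> Prop) (h0 : E 0) : ext :=
  match excluded_middle_informative (bound E) with
  | left hb => Some (proj1_sig (completeness E hb (ex_intro _ 0 h0)))
  | right _ => None
  end.

Lemma lint_set_0 mu g : lint_set mu g 0.
Proof. left; reflexivity. Qed.

Definition lint (mu : (R -> Prop) -> R) (g : R -> ext) : ext :=
  sup_ext (lint_set mu g) (lint_set_0 mu g).

Definition ext_pos (f : R -> ext) (x : R) : ext :=
  match f x with None => None | Some v => Some (Rmax v 0) end.
Definition ext_neg (f : R -> ext) (x : R) : ext :=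
  match f x with None => Some 0 | Some v => Some (Rmax (- v) 0) end.

(* integral of an (-oo,+oo]-valued function whose negative part has finite
   integral: int f^+ - int f^-  (value +oo allowed). If the negative part has
   infinite integral the integral is undefined; we return +oo by convention
   (this case never occurs below, the integrands being bounded below). *)
Definition integral (mu : (R -> Prop) -> R) (f : R -> ext) : ext :=
  match lint mu (ext_neg f) with
  | Some n => match lint mu (ext_pos f) with
              | Some p => Some (p - n)
              | None => None
              end
  | None => None
  end.

(* integrand log (1 / (|z - t| w(z) w(t))) on [a,b]^2, = +oo where the product
   vanishes; outside [a,b]^2 (a mu x mu null set) it is set to 0. *)
Definition log_kernel (a b : R) (w : R -> R) (z t : R) : ext :=
  if excluded_middle_informative (a <= z <= b /\ a <= t <= b) then
    (if Req_EM_T (Rabs (z - t) * w z * w t) 0 then None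
     else Some (ln (/ (Rabs (z - t) * w z * w t))))
  else Some 0.

(* I_w(mu) = double integral (written as the iterated integral, Tonelli) *)
Definition energy (a b : R) (w : R -> R) (mu : (R -> Prop) -> R) : ext :=
  integral mu (fun z => integral mu (fun t => log_kernel a b w z t)).

Definition energy_vals (a b : R) (w : R -> R) (v : R) : Prop :=
  exists mu, unit_measure_on a b mu /\ energy a b w mu = Some v.

(* cap([a,b],w) = exp(-V_w), V_w = inf I_w.  If no measure has finite energy,
   V_w = +oo and cap = 0.  (V_w = -oo cannot occur for bounded w; we put 0.) *)
Definition weighted_cap (a b : R) (w : R -> R) : R :=
  match excluded_middle_informative (exists v, energy_vals a b w v) with
  | right _ => 0
  | left hne =>
    match excluded_middle_informative (bound (fun y => energy_vals a b w (- y))) with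
    | right _ => 0
    | left hb =>
      let hne' : exists y, energy_vals a b w (- y) :=
        match hne with ex_intro _ v hv =>
          ex_intro _ (- v) (eq_ind_r (fun u => energy_vals a b w u) hv (Ropp_involutive v))
        end in
      (* sup of -E = - inf E, so exp(-V_w) = exp(sup(-E)) *)
      exp (proj1_sig (completeness _ hb hne'))
    end
  end.

Definition prod_weight (k : nat) (Q : nat -> list Z) (al : nat -> R) (x : R) : R :=
  fold_right Rmult 1 (map (fun i => rpow (Rabs (peval (Q i) x)) (al i)) (seq 0 k)).

Definition alpha_sum (k : nat) (m : nat -> nat) (al : nat -> R) : R :=
  fold_right Rplus 0 (map (fun i => al i * INR (m i)) (seq 0 k)).

(* Main.v *)
(* Write V = - log c_w.  For each n take the even integer polynomial weight
   W = prod Q_i ^ (2 e_i), where e_i exceeds n alpha_i by at most 1, of degree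
   D ~ 2 alpha n, and the Hankel matrix of the moments of W on [0, 1].  Its
   determinant is positive, and multiplying the i-th row by lcm(1, ..., n + D + i)
   makes the entries integers, so the sum of psi(n + D + i) over i < n is at least
   - log det.  On the other hand det is at most the maximum over [0, 1]^n of
   prod_i W(x_i) prod_{i <> j} |x_i - x_j|: the ratio of consecutive determinants
   is a least weighted L^2 norm of monic polynomials, hence at most the ratio of
   consecutive maxima.  Near-maximal points are polynomially separated by Markov's
   inequality, so spreading each of them uniformly over a tiny interval gives a
   measure of energy at most - log(max) / n^2 + O(log n / n); hence
   - log(max) >= V n^2 - O(n log n).  Therefore the integral of psi from
   (1 + 2 alpha) n to (2 + 2 alpha) n is at least V n^2 - O(n log n), and summing
   over geometric scales gives the theorem. *)

(* The exponents are rounded up because then [W] is at most a constant times w^(2n) on [0, 1]; after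
   rounding down this would fail near the zeros of the Q_i. The capacity is an infimum over
   measures, and point masses have infinite energy. The near-maximal points are therefore spread
   over intervals so short that neither the weight nor the distances change much. The length h of
   these intervals enters the energy only through log(1/h) / n, so any polynomial lower bound for
   the separation is enough: a weak Markov inequality suffices, and so do points within a factor 2
   of a supremum that is never shown to be attained. The constant is (2 + 2 alpha)^2 - (1 + 2
   alpha)^2 = 4 alpha + 3: with K = V / (4 alpha + 3), the function K x^2 grows by exactly V n^2
   between (1 + 2 alpha) n and (2 + 2 alpha) n. If V <= 0 the bound follows from psi >= 0. This
   covers the conventional value 0 of the capacity, because [ln 0] is 0. *)
From Stdlib Require Reals Lra Znumtheory.
From Coquelicot Require Coquelicot.
From mathcomp Require zify.
Require Defs.

(** * Integrals of step functions *)

Module StepIntegral.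

From Stdlib Require Import Reals Lra.
From Coquelicot Require Import Coquelicot.
Local Open Scope R_scope.

Section StepIntegral.
Variables (f : R -> R) (g : nat -> R).
Hypothesis fg : forall m x, INR m <= x < INR m + 1 -> f x = g m.
Hypothesis g0 : forall m, 0 <= g m.

Lemma is_RInt_step m b : INR m <= b <= INR m + 1 -> is_RInt f (INR m) b ((b - INR m) * g m).
Proof.
intros Hb; apply (is_RInt_ext (fun _ => g m)).
- intros x; rewrite Rmin_left, Rmax_right by lra; intros Hx.
  symmetry; apply fg; lra.
- exact (is_RInt_const (INR m) b (g m)).
Qed.

Fixpoint step_sum (n : nat) : R :=
  match n with O => 0 | S k => step_sum k + g (S k) end.

Lemma is_RInt_step_sum n : is_RInt f 1 (INR (S n)) (step_sum n).
Proof.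
induction n as [|n IH]; simpl step_sum.
- exact (is_RInt_point f 1).
- apply (is_RInt_Chasles f 1 (INR (S n))); [exact IH|].
  replace (g (S n)) with ((INR (S (S n)) - INR (S n)) * g (S n)) by (rewrite (S_INR (S n)); ring).
  apply is_RInt_step; rewrite (S_INR (S n)); lra.
Qed.

(** The last, incomplete interval contributes a nonnegative amount and is dropped. *)
Lemma RiemannInt_step_ge x n : INR (S n) <= x < INR (S n) + 1 ->
  exists pr : Riemann_integrable f 1 x, step_sum n <= RiemannInt pr.
Proof.
intros Hx.
assert (H : is_RInt f 1 x (step_sum n + (x - INR (S n)) * g (S n))).
{ apply (is_RInt_Chasles f 1 (INR (S n))); [apply is_RInt_step_sum|].
  apply is_RInt_step; lra. }
assert (E : ex_RInt f 1 x) by (eexists; exact H).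
exists (ex_RInt_Reals_0 _ _ _ E).
rewrite <- RInt_Reals, (is_RInt_unique _ _ _ _ H).
assert (0 <= (x - INR (S n)) * g (S n)) by (apply Rmult_le_pos; [lra|apply g0]).
lra.
Qed.

End StepIntegral.

Lemma bound_rearrange l d x C L :
  (-2 * l) / d * (x ^ 2 / 2) - C * (x * L ^ 2) = - l / d * x ^ 2 - C * (x * L ^ 2).
Proof. unfold Rdiv; generalize (/ d); intros e; field. Qed.

End StepIntegral.

Module ChebyshevBound.

From HB Require Import structures.
From mathcomp Require Import all_boot all_order all_algebra.
From mathcomp Require Import polyrcf.
From mathcomp Require Import Rstruct Rstruct_topology.
From mathcomp Require Import all_classical all_reals all_analysis.
From mathcomp Require Import measurable_realfun.
From mathcomp Require Import ring lra zify.
Set Implicit Arguments. Unset Strict Implicit. Unset Printing Implicit Defensive.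
Import Order.TTheory GRing.Theory Num.Theory.
Import HBSimple HBNNSimple.
Local Open Scope ring_scope.

(** * Gram determinants of moments *)

Section PolynomialIntegral.
Variable R : realType.
Implicit Types p q f g : {poly R}.

Definition pprim p : {poly R} :=
  \poly_(i < (size p).+1) (if i is j.+1 then p`_j / j.+1%:R else 0).

Lemma coef_pprim p i : (pprim p)`_i = if i is j.+1 then p`_j / j.+1%:R else 0.
Proof.
rewrite coef_poly; case: i => [|i]; rewrite ?ltnS //.
by case: ltnP => // /(nth_default 0) ->; rewrite mul0r.
Qed.

Lemma deriv_pprim p : (pprim p)^`() = p.
Proof.
by apply/polyP => i; rewrite coef_deriv coef_pprim -[LHS]mulr_natr divfK // pnatr_eq0.
Qed.

(** The integral of [p] over [0, 1] in algebraic form: linearity and the values 1/(n+1) on monomials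
    become exact identities, as the integrality argument requires. *)
Definition pint p : R := (pprim p).[1].

Lemma pint_is_scalar : scalar pint.
Proof.
move=> a p q; rewrite /pint.
suff -> : pprim (a *: p + q) = a *: pprim p + pprim q by rewrite hornerD hornerZ.
apply/polyP => i; rewrite coefD coefZ !coef_pprim; case: i => [|i]; first by rewrite mulr0 addr0.
by rewrite coefD coefZ mulrDl mulrA.
Qed.

HB.instance Definition _ := GRing.isLinear.Build R {poly R} R *%R pint pint_is_scalar.

Lemma pintXn n : pint 'X^n = n.+1%:R^-1.
Proof.
rewrite /pint; have -> : pprim 'X^n = n.+1%:R^-1 *: 'X^(n.+1).
  apply/polyP => i; rewrite coef_pprim coefZ !coefXn; case: i => [|i]; first by rewrite mulr0.
  by rewrite eqSS coefXn mulrC; case: eqVneq => [->|_] //=; rewrite !mulr0.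
by rewrite hornerZ hornerXn expr1n mulr1.
Qed.

Lemma pprim0 p : (pprim p).[0] = 0.
Proof. by rewrite horner_coef0 coef_pprim. Qed.

(** The mean value theorem for the primitive. It turns an integral into a value at a point of
    [0, 1], which can later serve as an additional Fekete point. *)
Lemma pint_mvt p : exists2 c, 0 <= c <= 1 & pint p = p.[c].
Proof.
have [c cI] := poly_mvt (pprim p) (@ltr01 R).
rewrite pprim0 deriv_pprim !subr0 mulr1 => e; exists c => //.
by move: cI; rewrite in_itv /= => /andP[/ltW-> /ltW->].
Qed.

Lemma pint_sqr_ge0 q : 0 <= pint (q ^+ 2).
Proof. by have [c _ ->] := pint_mvt (q ^+ 2); rewrite horner_exp sqr_ge0. Qed.

(** The primitive of [q ^+ 2] is nondecreasing and starts at 0. If it also ended at 0 it would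
    vanish on all of [0, 1], hence identically, and so would its derivative. *)
Lemma pint_sqr_gt0 q : q != 0 -> 0 < pint (q ^+ 2).
Proof.
move=> q0; rewrite lt_neqAle pint_sqr_ge0 andbT; apply: contra q0 => /eqP e.
have inc a b : a <= b -> (pprim (q ^+ 2)).[a] <= (pprim (q ^+ 2)).[b].
  rewrite le_eqVlt => /orP[/eqP-> //|ab].
  have [c _] := poly_mvt (pprim (q ^+ 2)) ab.
  rewrite deriv_pprim horner_exp => e'; rewrite -subr_ge0 e'.
  by rewrite mulr_ge0 ?sqr_ge0 // subr_ge0 ltW.
have vanish t : 0 <= t <= 1 -> root (pprim (q ^+ 2)) t.
  move=> /andP[t0 t1]; rewrite rootE eq_le.
  by rewrite -{2}(pprim0 (q ^+ 2)) inc // andbT e inc.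
have : pprim (q ^+ 2) = 0.
  (* The points 1/(k+1) supply as many distinct roots as the size of the polynomial, one more than
     its degree allows. *)
  pose s := [seq (k.+1%:R : R)^-1 | k <- iota 0 (size (pprim (q ^+ 2)))].
  apply/eqP; apply: contraT => n0.
  have := @max_poly_roots _ _ s n0.
  rewrite size_map size_iota ltnn => ->//.
    apply/allP => _ /mapP[k _ ->]; apply: vanish.
    by rewrite invr_ge0 ler0n invf_le1 ?ltr0n // ler1n.
  rewrite map_inj_uniq ?iota_uniq // => i j /invr_inj /eqP.
  by rewrite eqr_nat eqSS => /eqP.
move/(congr1 (@deriv R)); rewrite deriv_pprim deriv0 => /eqP.
by rewrite expf_eq0.
Qed.

End PolynomialIntegral.

Section Gram.
Variables (R : realType) (q : {poly R}).
Hypothesis q0 : q != 0.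
Let w := q ^+ 2.

Definition moment n : 'M[R]_n := \matrix_(i, j) pint ('X^(i + j) * w).

Lemma pint_mulw_sqr_gt0 f : f != 0 -> 0 < pint (f ^+ 2 * w).
Proof. by move=> f0; rewrite -exprMn pint_sqr_gt0 // mulf_neq0. Qed.

Lemma pint_mulw_sqr_ge0 f : 0 <= pint (f ^+ 2 * w).
Proof. by rewrite -exprMn pint_sqr_ge0. Qed.

Lemma rVpolyE n (u : 'rV[R]_n) : rVpoly u = \sum_(i < n) u 0 i *: 'X^i.
Proof.
rewrite {1}(matrix_sum_delta u) big_ord1 linear_sum /=.
by apply: eq_bigr => i _; rewrite linearZ /= rVpoly_delta.
Qed.

Lemma moment_mul n (u : 'rV[R]_n) (j : 'I_n) :
  (u *m moment n) 0 j = pint (rVpoly u * 'X^j * w).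
Proof.
rewrite mxE rVpolyE 2!mulr_suml linear_sum /=; apply: eq_bigr => i _.
by rewrite mxE -scalerAl -exprD -scalerAl linearZ.
Qed.

(* The last orthogonal polynomial minimises the weighted [L^2] norm among monic
   polynomials of its degree; its squared norm is the ratio of consecutive
   determinants. *)
Lemma det_moment_rec n : 0 < \det (moment n) ->
  exists h, [/\ 0 < h, \det (moment n.+1) = \det (moment n) * h &
    forall p, p \is monic -> size p = n.+1 -> h <= pint (p ^+ 2 * w)].
Proof.
move=> dn.
have Mu : moment n \in unitmx by rewrite unitmxE unitfE gt_eqF.
pose b : 'cV[R]_n := \col_i pint ('X^(i + n) * w).
pose c : R := pint ('X^(n + n) * w).
(* The coefficients of the orthogonal projection of ['X^n] on the polynomials of smaller degree; the
   remainder [g] is the monic orthogonal polynomial. *)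
pose u : 'rV[R]_n := b^T *m invmx (moment n).
have um : u *m moment n = b^T by rewrite mulmxKV.
pose g : {poly R} := 'X^n - rVpoly u.
have su : (size (rVpoly u) <= n)%N by rewrite size_poly.
have sg : size g = n.+1 by rewrite size_polyDl size_polyXn // size_polyN ltnS.
have gmon : g \is monic.
  by rewrite monicE lead_coefDl ?lead_coefXn // size_polyN size_polyXn ltnS.
have orth (r : {poly R}) : (size r <= n)%N -> pint (g * r * w) = 0.
  move=> sr; rewrite -(poly_rV_K sr) (rVpolyE (poly_rV r)) mulr_sumr mulr_suml linear_sum /=.
  apply: big1 => j _; rewrite -scalerAr -scalerAl linearZ /=.
  rewrite mulrBl mulrBl linearB /= -moment_mul um !mxE -exprD addnC subrr.
  by rewrite mulr0.
(* The squared norm of [g] is the Schur complement of [moment n] in [moment n.+1]. *)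
have hE : pint (g ^+ 2 * w) = c - (u *m b) 0 0.
  rewrite expr2 {1}/g mulrBr mulrBl linearB /= (orth _ su) subr0.
  rewrite mulrBl mulrBl linearB /= -exprD; congr (_ - _).
  rewrite rVpolyE 2!mulr_suml linear_sum mxE /=; apply: eq_bigr => i _.
  by rewrite -scalerAl -exprD -scalerAl linearZ [b _ _]mxE.
exists (pint (g ^+ 2 * w)); split.
- by apply: pint_mulw_sqr_gt0; rewrite -size_poly_gt0 sg.
- have -> : \det (moment n.+1) = \det (block_mx (moment n) b b^T c%:M).
    have e : n.+1 = (n + 1)%N by rewrite addn1.
    transitivity (\det (castmx (e, e) (moment n.+1))); first by case: _ / e.
    congr (\det _); apply/matrixP => i j; rewrite castmxE.
    case: (split_ordP i) => i' ->; case: (split_ordP j) => j' ->;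
      rewrite ?block_mxEul ?block_mxEur ?block_mxEdl ?block_mxEdr !mxE /=; do ?rewrite (ord1 i'); do ?rewrite (ord1 j');
      rewrite ?addn0 ?eqxx ?mulr1n //.
    by rewrite addnC.
  have -> : block_mx (moment n) b b^T c%:M =
      block_mx 1%:M 0 u 1%:M *m block_mx (moment n) b 0 (c%:M - u *m b).
    rewrite mulmx_block !mul1mx !mul0mx !addr0 um.
    by rewrite addrC subrK.
  rewrite det_mulmx det_lblock det_ublock !det1 !mul1r hE; congr (_ * _).
  by rewrite det_mx11 !mxE eqxx mulr1n.
- move=> p pmon sp.
  pose r := p - g.
  have sr : (size r <= n)%N.
    apply/leq_sizeP => j; rewrite leq_eqVlt => /orP[/eqP<-|nj].
      rewrite coefB; have -> : p`_n = lead_coef p by rewrite /lead_coef sp.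
      have -> : g`_n = lead_coef g by rewrite /lead_coef sg.
      by rewrite (monicP pmon) (monicP gmon) subrr.
    by rewrite coefB !nth_default ?subrr ?sp ?sg.
  (* Pythagoras: [r = p - g] has degree below [n], so it is orthogonal to [g]. *)
  have -> : p ^+ 2 * w = g ^+ 2 * w + (g * r * w + g * r * w) + r ^+ 2 * w.
    by rewrite /r; ring.
  rewrite !linearD /= orth // !addr0.
  by rewrite lerDl pint_mulw_sqr_ge0.
Qed.

Lemma det_moment_gt0 n : 0 < \det (moment n).
Proof.
elim: n => [|n IH]; first by rewrite det_mx00.
by have [h [h0 -> _]] := det_moment_rec IH; rewrite mulr_gt0.
Qed.

End Gram.

(** * Fekete products *)

Lemma prod_le1 (R : numDomainType) (I : Type) (r : seq I) (P : pred I) (f : I -> R) :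
  (forall i, P i -> 0 <= f i <= 1) -> 0 <= \prod_(i <- r | P i) f i <= 1.
Proof.
move=> h; elim/big_ind: _ => //; first by rewrite ler01 lexx.
by move=> x y /andP[x0 x1] /andP[y0 y1]; rewrite mulr_ge0 //= mulr_ile1.
Qed.

Section Fekete.
Variable R : realType.
Implicit Types (W : {poly R}) (x : nat -> R).

Definition unit_points k x := forall i, (i < k)%N -> 0 <= x i <= 1.

(** Both orders of a pair occur, so apart from the weight this is the square of a Vandermonde
    determinant. *)
Definition fekete W k x : R := (\prod_(i < k) W.[x i]) *
  \prod_(i < k) \prod_(j < k | j != i :> nat) `|x i - x j|.

(** The factor contributed by a new point is the value there of [p ^+ 2 * W], where [p] is the monic
    polynomial whose roots are the old points. *)
Lemma fekete_rec W k x : fekete W k.+1 x =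
  fekete W k x * (W.[x k] * \prod_(j < k) (x k - x j) ^+ 2).
Proof.
rewrite /fekete big_ord_recr /= -!mulrA; congr (_ * _).
rewrite mulrCA; congr (_ * _).
rewrite big_ord_recr /= [X in _ * X]big_mkcond big_ord_recr /= eqxx mulr1.
rewrite -big_mkcond /=.
rewrite [in X in _ * X](eq_bigl xpredT) => [|j]; last by rewrite neq_ltn ltn_ord.
rewrite (eq_bigr (fun i : 'I_k =>
   (\prod_(j < k | j != i :> nat) `|x i - x j|) * `|x i - x k|)); last first.
  move=> i _; rewrite big_mkcond big_ord_recr /= -big_mkcond /=.
  by rewrite gtn_eqF.
rewrite big_split -mulrA -big_split /=; congr (_ * _); apply: eq_bigr => j _.
by rewrite (distrC (x j)) -normrM -expr2 ger0_norm // sqr_ge0.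
Qed.

Lemma fekete_ge0 W k x : (forall t, 0 <= W.[t]) -> 0 <= fekete W k x.
Proof.
move=> W0; rewrite mulr_ge0 ?prodr_ge0 // => i _.
by rewrite prodr_ge0.
Qed.

Definition fekete_max W k : R :=
  sup [set y | exists2 x, unit_points k x & y = fekete W k x]%classic.

Variable W : {poly R}.
Hypothesis W0 : forall t, 0 <= W.[t].

Lemma fekete_has_sup k :
  has_sup [set y | exists2 x, unit_points k x & y = fekete W k x]%classic.
Proof.
split; first by exists (fekete W k (fun=> 0)), (fun=> 0) => // i _; rewrite lexx ler01.
have [B hB] := poly_itv_bound W 0 1.
have B0 : 0 <= B by apply: le_trans (hB 0 _); rewrite ?normr_ge0 ?lexx ?ler01.
exists (B ^+ k) => _ [x hx ->].
rewrite /fekete -[leRHS]mulr1 ler_pM ?prodr_ge0 //.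
- by move=> i _; apply: prodr_ge0.
- rewrite -[in leRHS](card_ord k) -prodr_const; apply: ler_prod => i _.
  by rewrite W0 (le_trans (ler_norm _)) // hB // hx.
- apply: (andP (prod_le1 _ _)).2 => i _; apply: prod_le1 => j _.
  rewrite normr_ge0 /= ler_norml.
  move: (hx _ (ltn_ord i)) (hx _ (ltn_ord j)); lra.
Qed.

Lemma fekete_le_max k x : unit_points k x -> fekete W k x <= fekete_max W k.
Proof. by move=> hx; apply: sup_upper_bound; [exact: fekete_has_sup|exists x]. Qed.

Lemma fekete_max_adherent k c : c < fekete_max W k ->
  exists2 x, unit_points k x & c < fekete W k x.
Proof.
rewrite -subr_gt0 => hc.
have [_ [x hx ->]] := sup_adherent hc (fekete_has_sup k).
by rewrite subKr; exists x.
Qed.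

End Fekete.

(** * Gram determinants against Fekete maxima *)

Section DetBound.
Variables (R : realType) (q : {poly R}).
Hypothesis q0 : q != 0.
Local Notation w := (q ^+ 2).

Lemma sqr_horner_ge0 t : 0 <= w.[t].
Proof. by rewrite horner_exp sqr_ge0. Qed.

Lemma det_moment_le_fekete n : \det (moment q n) <= fekete_max w n.
Proof.
elim: n => [|n IH].
  rewrite det_mx00; apply: le_trans (fekete_le_max sqr_horner_ge0 (x := fun=> 0) _) => //.
  by rewrite /fekete !big_ord0 mulr1.
have [h [h0 -> hmin]] := det_moment_rec q0 (det_moment_gt0 q0 n).
apply: (@le_trans _ _ (fekete_max w n * h)); first by rewrite ler_pM2r.
rewrite -ler_pdivlMr //; apply: sup_le_ub.
  by have [] := fekete_has_sup sqr_horner_ge0 n.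
move=> _ [x hx ->]; rewrite ler_pdivlMr //.
(* The minimality of [h] is tested on the monic polynomial with roots at the given points; the mean
   value point [c] of its weighted square becomes the new point. *)
pose p := \prod_(j < n) ('X - (x j)%:P).
have pm : p \is monic by apply: monic_prod_XsubC.
have sp : size p = n.+1 by rewrite size_prod_XsubC /index_enum -enumT size_enum_ord.
have [c c01 ec] := pint_mvt (p ^+ 2 * w).
have := hmin p pm sp; rewrite ec => hc.
apply: (@le_trans _ _ (fekete w n x * (p ^+ 2 * w).[c])).
  by rewrite ler_wpM2l // fekete_ge0 // => t; apply: sqr_horner_ge0.
pose y i := if (i < n)%N then x i else c.
have -> : fekete w n x * (p ^+ 2 * w).[c] = fekete w n.+1 y.
  rewrite fekete_rec; congr (_ * _).
    rewrite /fekete; congr (_ * _); first by apply: eq_bigr => i _; rewrite /y ltn_ord.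
    by apply: eq_bigr => i _; apply: eq_bigr => j _; rewrite /y !ltn_ord.
  rewrite hornerM mulrC {1 2}/y ltnn; congr (_ * _).
  rewrite horner_exp horner_prod -prodrXl; apply: eq_bigr => j _.
  by rewrite /y ltn_ord hornerXsubC.
apply: fekete_le_max; first exact: sqr_horner_ge0.
by move=> i _; rewrite /y; case: ltnP => // /hx.
Qed.

End DetBound.

(** * Clearing the denominators of the moments *)

Section Integrality.
Variables (R : realType) (z : {poly int}) (D : nat) (L : nat -> nat).
Hypothesis z0 : z != 0.
Hypothesis sz : (size (z ^+ 2) <= D.+1)%N.
Hypothesis L0 : forall m, (0 < L m)%N.
Hypothesis dvdL : forall k m, (0 < k <= m)%N -> (k %| L m)%N.
Local Notation q := (map_poly (intr : int -> R) z).

Lemma one_le_lcm_fekete n :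
  1 <= (\prod_(i < n) L (n + D + i))%:R * fekete_max (q ^+ 2) n.
Proof.
have q0 : q != 0 by rewrite map_poly_eq0_id0 // intr_eq0 lead_coef_eq0.
have lt0 : 0 < (\prod_(i < n) L (n + D + i))%:R :> R.
  by rewrite ltr0n prodn_gt0.
apply: (@le_trans _ _ ((\prod_(i < n) L (n + D + i))%:R * \det (moment q n))); last first.
  by rewrite ler_pM2l // det_moment_le_fekete.
(* Row [i] has denominators [i + j + k + 1] with [j < n] and [k <= D]. They are at most [n + D + i],
   so they all divide [L (n + D + i)]. *)
pose A : 'M[int]_n := \matrix_(i, j) \sum_(k < D.+1)
   (z ^+ 2)`_k * (L (n + D + i) %/ (i + j + k).+1)%N%:Z.
have detE : (\prod_(i < n) L (n + D + i))%:R * \det (moment q n) = (\det A)%:~R.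
  have -> : (\prod_(i < n) L (n + D + i))%:R =
      \det (diag_mx (\row_(i < n) (L (n + D + i))%:R)) :> R.
    by rewrite det_diag natr_prod; apply: eq_bigr => i _; rewrite mxE.
  rewrite -det_map_mx -det_mulmx; congr (\det _).
  apply/matrixP => i j; rewrite mul_diag_mx !mxE rmorph_sum /=.
  have zE : z ^+ 2 = \sum_(k < D.+1) (z ^+ 2)`_k *: 'X^k.
    rewrite -poly_def; apply/polyP => k; rewrite coef_poly; case: ltnP => // h.
    by rewrite nth_default // (leq_trans sz).
  have -> : 'X^(i + j) * q ^+ 2 =
      \sum_(k < D.+1) ((z ^+ 2)`_k)%:~R *: 'X^(i + j + k) :> {poly R}.
    rewrite -rmorphXn /= {1}zE rmorph_sum mulr_sumr; apply: eq_bigr => k _.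
    by rewrite /= map_polyZ map_polyXn -scalerAr -exprD.
  rewrite linear_sum mulr_sumr; apply: eq_bigr => k _.
  rewrite linearZ /= pintXn rmorphM /= mulrCA; congr (_ * _).
  have /dvdnP[c ->] : ((i + j + k).+1 %| L (n + D + i))%N.
    by apply: dvdL; have := ltn_ord j; have := ltn_ord k; lia.
  by rewrite mulnK // natrM mulfK ?pnatr_eq0 // pmulrn.
have := mulr_gt0 lt0 (det_moment_gt0 q0 n).
by rewrite detE ltr0z gtz0_ge1 ler1z.
Qed.

End Integrality.

(** * A weak Markov inequality *)

Section Markov.
Variable R : realType.
Implicit Types (f g : R -> R) (x y t : R).

Lemma normr_sin_mulrn_le k x : `|sin (k%:R * x)| <= k%:R * `|sin x|.
Proof.
elim: k => [|k IH]; first by rewrite !mul0r sin0 normr0.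
rewrite -natr1 mulrDl mul1r sinD mulrDl mul1r (le_trans (ler_normD _ _)) //.
rewrite !normrM lerD //.
  by rewrite (le_trans _ IH) // ler_piMr // ler_norml cos_geN1 cos_le1.
by rewrite ler_piMl // ler_norml cos_geN1 cos_le1.
Qed.

Lemma cosB_prod x y : cos x - cos y = - (sin ((x + y) / 2) * sin ((x - y) / 2)) *+ 2.
Proof.
have {1}-> : x = (x + y) / 2 + (x - y) / 2 by field.
have {3}-> : y = (x + y) / 2 - (x - y) / 2 by field.
by rewrite cosD cosB; ring.
Qed.

(* Chebyshev polynomials of degree [k] are [k ^ 2]-Lipschitz on [[-1, 1]]. *)
Lemma cos_mulrn_lipschitz k x y :
  `|cos (k%:R * x) - cos (k%:R * y)| <= k%:R ^+ 2 * `|cos x - cos y|.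
Proof.
rewrite !cosB_prod -mulrDr -mulrBr -!mulrA !normrMn !normrN !normrM.
set A := `|sin ((x + y) / 2)|; set B := `|sin ((x - y) / 2)|.
have -> : k%:R * (k%:R * (A * B *+ 2)) = (k%:R * A) * (k%:R * B) *+ 2 by ring.
by rewrite lerMn2r /= ler_pM //; exact: normr_sin_mulrn_le.
Qed.

(** The substitution x = (1 + cos t) / 2 carries polynomials of degree at most [N] on [0, 1] to such
    sums; the numbers [a k] are then their Chebyshev coefficients. *)
Definition cos_sum N f :=
  exists a : nat -> R, forall t, f t = \sum_(k < N.+1) a k * cos (k%:R * t).

Lemma cos_sum_ext N f g : f =1 g -> cos_sum N f -> cos_sum N g.
Proof. by move=> fg [a h]; exists a => t; rewrite -fg. Qed.

Lemma cos_sumD N f g : cos_sum N f -> cos_sum N g -> cos_sum N (fun t => f t + g t).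
Proof.
move=> [a ha] [b hb]; exists (fun k => a k + b k) => t.
by rewrite ha hb -big_split; apply: eq_bigr => k _; rewrite mulrDl.
Qed.

Lemma cos_sumZ N c f : cos_sum N f -> cos_sum N (fun t => c * f t).
Proof.
move=> [a ha]; exists (fun k => c * a k) => t.
by rewrite ha mulr_sumr; apply: eq_bigr => k _; rewrite mulrA.
Qed.

Lemma cos_sum_cos N k : (k <= N)%N -> cos_sum N (fun t => cos (k%:R * t)).
Proof.
rewrite -ltnS => kN; exists (fun j => (j == k)%:R) => t.
rewrite (bigD1 (Ordinal kN)) //= eqxx mul1r big1 ?addr0 // => j.
by rewrite -val_eqE /= => /negbTE->; rewrite mul0r.
Qed.

Lemma cos_sum0 N : cos_sum N (fun=> 0).
Proof. by exists (fun=> 0) => t; rewrite big1 // => k _; rewrite mul0r. Qed.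

Lemma cos_sum_bigop N (I : Type) (r : seq I) (F : I -> R -> R) :
  (forall i, cos_sum N (F i)) -> cos_sum N (fun t => \sum_(i <- r) F i t).
Proof.
move=> h; elim: r => [|i r IH].
  by apply: cos_sum_ext (cos_sum0 N) => t; rewrite big_nil.
by apply: cos_sum_ext (cos_sumD (h i) IH) => t; rewrite big_cons.
Qed.

Lemma cos_sum_mul_cos N f : cos_sum N f -> cos_sum N.+1 (fun t => cos t * f t).
Proof.
move=> [a ha].
apply: (@cos_sum_ext _ (fun t => \sum_(k < N.+1) a k * (cos t * cos (k%:R * t)))).
  by move=> t; rewrite ha mulr_sumr; apply: eq_bigr => k _; rewrite mulrCA.
apply: cos_sum_bigop => k; apply: cos_sumZ.
case: k => -[|k] kN /=.
  apply: cos_sum_ext (cos_sum_cos (isT : (1 <= N.+1)%N)) => t.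
  by rewrite mul0r cos0 mulr1 mul1r.
have h1 : cos_sum N.+1 (fun t => cos (k.+2%:R * t)) by apply: cos_sum_cos.
have h2 : cos_sum N.+1 (fun t => cos (k%:R * t)).
  by apply: cos_sum_cos; move: kN; lia.
apply: cos_sum_ext (cos_sumZ 2^-1 (cos_sumD h1 h2)) => t.
have -> : k.+2%:R * t = k.+1%:R * t + t by rewrite -[k.+2%:R]natr1; ring.
have -> : k%:R * t = k.+1%:R * t - t by rewrite -[k.+1%:R]natr1; ring.
by rewrite cosD cosB; field.
Qed.

Lemma cos_sumW N f : cos_sum N f -> cos_sum N.+1 f.
Proof.
move=> [a ha]; exists (fun k => if (k <= N)%N then a k else 0) => t.
rewrite big_ord_recr /= ltnn mul0r addr0 ha; apply: eq_bigr => k _.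
by rewrite -ltnS ltn_ord.
Qed.

Lemma horner_cos_sum (p : {poly R}) N : (size p <= N.+1)%N ->
  cos_sum N (fun t => p.[(1 + cos t) / 2]).
Proof.
elim: N p => [|N IH] p sp.
  exists (fun=> p`_0) => t; rewrite big_ord1 mul0r cos0 mulr1.
  by rewrite [in LHS](size1_polyC sp) hornerC.
have sd : (size (drop_poly 1 p) <= N.+1)%N by rewrite size_drop_poly; move: sp; lia.
have h := IH _ sd.
apply: cos_sum_ext (cos_sumD (cos_sumZ 2^-1 (cos_sumD (cos_sumW h) (cos_sum_mul_cos h)))
  (cos_sumZ p`_0 (cos_sum_cos (leq0n N.+1)))) => t.
rewrite mul0r cos0 mulr1 -[in RHS](poly_take_drop 1 p) hornerD hornerM hornerXn expr1.
have -> : take_poly 1 p = (p`_0)%:P.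
  by rewrite (size1_polyC (size_take_poly 1 p)) coef_take_poly.
by rewrite hornerC; field.
Qed.

(** Multiplication by 2 sin (x / 2), nonzero because x / 2 lies strictly between 0 and pi, makes the
    sum telescope over [r] full periods. *)
Lemma sum_cos_roots_of_unity m r : (0 < r < m)%N ->
  \sum_(j < m) cos (r%:R * (j%:R * (pi *+ 2 / m%:R))) = 0 :> R.
Proof.
move=> /andP[r0 rm].
have m0 : m%:R != 0 :> R by rewrite pnatr_eq0; case: m rm.
set x : R := r%:R * (pi *+ 2 / m%:R).
under eq_bigr => j _ do rewrite mulrCA -/x.
have mx : m%:R * x = r%:R * (pi *+ 2) by rewrite /x mulrCA; congr (_ * _); rewrite mulrC divfK.
have tel : \sum_(j < m) cos (j%:R * x) * (sin (x / 2) *+ 2) = 0.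
  have -> : \sum_(j < m) cos (j%:R * x) * (sin (x / 2) *+ 2) =
     \sum_(0 <= j < m) (sin (j.+1%:R * x - x / 2) - sin (j%:R * x - x / 2)).
    rewrite big_mkord; apply: eq_bigr => j _.
    have -> : j.+1%:R * x - x / 2 = j%:R * x + x / 2 by rewrite -natr1; field.
    by rewrite sinD sinB; ring.
  rewrite telescope_sumr // mx mul0r sub0r sinN opprK addrC.
  have -> : r%:R * (pi *+ 2) - x / 2 = - (x / 2) + (pi *+ 2) *+ r.
    by rewrite addrC mulr_natl.
  have per : forall k (t : R), sin (t + (pi *+ 2) *+ k) = sin t.
    elim => [|k IHk] t; first by rewrite mulr0n addr0.
    by rewrite mulrSr addrA sinD2pi IHk.
  by rewrite per sinN subrr.
move: tel; rewrite -mulr_suml => /eqP; rewrite mulf_eq0 => /orP[/eqP//|].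
rewrite mulrn_eq0 /= gt_eqF // sin_gt0_pi //.
have -> : x / 2 = r%:R / m%:R * pi by rewrite /x -mulr_natr; field.
rewrite mulr_gt0 ?pi_gt0 ?divr_gt0 ?ltr0n //=; last by case: m rm {m0 x mx}.
rewrite gtr_pMl ?pi_gt0 // ltr_pdivrMr ?mul1r ?ltr_nat // ltr0n.
by case: m rm {m0 x mx}.
Qed.

(** Discrete orthogonality at equally spaced nodes takes the place of Fourier integrals. *)
Lemma cos_coef_bound N M (a : nat -> R) :
  (forall t, `|\sum_(k < N.+1) a k * cos (k%:R * t)| <= M) ->
  forall l, (l <= N)%N -> `|a l| <= 2 * M.
Proof.
move=> hM l lN.
(* With [2 N + 1] nodes the frequencies [k + l] and [|k - l|] stay below [m], so their sums vanish
   unless the frequency is 0. *)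
pose m := N.*2.+1.
pose th (j : nat) : R := j%:R * (pi *+ 2 / m%:R).
have M0 : 0 <= M by apply: le_trans (hM 0); exact: normr_ge0.
have m0 : 0 < m%:R :> R by rewrite ltr0n.
pose Z r : R := \sum_(j < m) cos (r%:R * th j).
have Z0 r : (0 < r < m)%N -> Z r = 0 by exact: sum_cos_roots_of_unity.
have Z00 : Z 0%N = m%:R.
  rewrite /Z (eq_bigr (fun=> 1)) => [|j _]; last by rewrite mul0r cos0.
  by rewrite sumr_const card_ord.
have prodZ k : (k <= N)%N ->
    \sum_(j < m) cos (k%:R * th j) * cos (l%:R * th j) =
    if k == l then (Z (k + l)%N + m%:R) / 2 else 0.
  move=> kN.
  have E : \sum_(j < m) cos (k%:R * th j) * cos (l%:R * th j) =
      (Z (k + l)%N + Z (maxn k l - minn k l)%N) / 2.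
    rewrite /Z -big_split mulr_suml; apply: eq_bigr => j _ /=.
    have -> : (k + l)%:R * th j = k%:R * th j + l%:R * th j by rewrite natrD mulrDl.
    have -> : cos ((maxn k l - minn k l)%:R * th j) = cos (k%:R * th j - l%:R * th j).
      have [kl|kl] := leqP k l.
        by rewrite natrB // mulrBl -[RHS]cosN opprB.
      by rewrite natrB 1?ltnW // mulrBl.
    by rewrite cosD cosB; field.
  rewrite E; case: eqVneq => [->|kl].
    by rewrite maxnn minnn subnn Z00.
  have klP : (0 < k + l)%N by move: kl; lia.
  by rewrite !Z0 ?addr0 ?mul0r //; move: kl; rewrite /m; lia.
have S : \sum_(j < m) (\sum_(k < N.+1) a k * cos (k%:R * th j)) * cos (l%:R * th j)
    = a l * ((Z (l + l)%N + m%:R) / 2).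
  under eq_bigr do rewrite mulr_suml.
  rewrite exchange_big /= (eq_bigr (fun k : 'I_N.+1 => a k *
     (if k == l :> nat then (Z (k + l)%N + m%:R) / 2 else 0))); last first.
    move=> k _; rewrite -prodZ -1?ltnS // mulr_sumr.
    by apply: eq_bigr => j _; rewrite mulrA.
  have lN' : (l < N.+1)%N by [].
  rewrite (bigD1 (Ordinal lN')) //= eqxx big1 ?addr0 // => k.
  by rewrite -val_eqE /= => /negbTE->; rewrite mulr0.
(* The normalising factor is [m] for [l = 0] and [m / 2] otherwise; the smaller value yields the
   constant 2. *)
have Zl : m%:R / 2 <= (Z (l + l)%N + m%:R) / 2.
  rewrite ler_pM2r ?invr_gt0 // lerDr.
  case: l lN {prodZ S} => [|l] lN; first by rewrite addn0 Z00 ltW.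
  by rewrite Z0 // /m; lia.
have bS : `|\sum_(j < m) (\sum_(k < N.+1) a k * cos (k%:R * th j)) * cos (l%:R * th j)|
    <= m%:R * M.
  apply: le_trans (ler_norm_sum _ _ _) _.
  rewrite mulr_natl -[X in _ <= _ *+ X]card_ord -sumr_const; apply: ler_sum => j _.
  rewrite normrM -[leRHS]mulr1 ler_pM // ler_norml cos_geN1 cos_le1 //.
rewrite S normrM in bS.
have : `|a l| * (m%:R / 2) <= m%:R * M.
  apply: le_trans bS; rewrite ler_wpM2l //.
  by apply: le_trans Zl _; exact: ler_norm.
rewrite [leLHS]mulrCA ler_pM2l // ler_pdivrMr // => h.
by rewrite mulrC.
Qed.

(* A weak form of Markov's inequality, read off the Chebyshev expansion. *)
Lemma poly_lipschitz (p : {poly R}) N M : (size p <= N.+1)%N ->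
  (forall x, 0 <= x <= 1 -> `|p.[x]| <= M) ->
  forall x y, 0 <= x <= 1 -> 0 <= y <= 1 ->
  `|p.[x] - p.[y]| <= 4 * N.+1%:R ^+ 3 * M * `|x - y|.
Proof.
move=> sp hM x y x01 y01.
have [a ha] := horner_cos_sum sp.
have hM' t : `|\sum_(k < N.+1) a k * cos (k%:R * t)| <= M.
  by rewrite -ha hM // ; have := cos_le1 t; have := cos_geN1 t; lra.
have ab := cos_coef_bound hM'.
have param z : 0 <= z <= 1 -> exists t, z = (1 + cos t) / 2.
  move=> z01; exists (acos (2 * z - 1)); rewrite acosK ?in_itv /=; last by lra.
  by field.
have [s ->] := param x x01; have [t ->] := param y y01.
have -> : (1 + cos s) / 2 - (1 + cos t) / 2 = (cos s - cos t) / 2 by field.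
rewrite !ha -sumrB.
apply: le_trans (ler_norm_sum _ _ _) _.
have M0 : 0 <= M by apply: le_trans (hM' 0); exact: normr_ge0.
(* There are [N + 1] terms, with coefficients at most [2 M] and Lipschitz constants [k ^ 2], crudely
   [(N + 1) ^ 2]; the remaining factor 2 comes from rescaling [-1, 1] to [0, 1]. *)
apply: (@le_trans _ _ (\sum_(k < N.+1) 2 * M * (N.+1%:R ^+ 2 * `|cos s - cos t|))).
  apply: ler_sum => k _; rewrite -mulrBr normrM ler_pM //.
    by apply: ab; rewrite -ltnS.
  apply: le_trans (cos_mulrn_lipschitz _ _ _) _.
  by rewrite ler_wpM2r // lerXn2r ?nnegrE ?ler0n // ler_nat ltnW.
have -> : `|(cos s - cos t) / 2| = `|cos s - cos t| / 2.
  by rewrite normrM [X in _ * X]ger0_norm // invr_ge0.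
rewrite sumr_const card_ord -mulr_natl.
by rewrite le_eqVlt; apply/orP; left; apply/eqP; field.
Qed.

End Markov.

(** * Separation of near-Fekete points *)

Lemma ln_prod (F : realType) (I : Type) (r : seq I) (Q : pred I) (f : I -> F) :
  (forall i, Q i -> 0 < f i) ->
  ln (\prod_(i <- r | Q i) f i) = \sum_(i <- r | Q i) ln (f i).
Proof.
move=> f0.
suff : 0 < \prod_(i <- r | Q i) f i /\
    ln (\prod_(i <- r | Q i) f i) = \sum_(i <- r | Q i) ln (f i) by case.
elim/big_rec2: _ => [|i s p Qi [p0 pE]]; first by rewrite ln1.
by split; [rewrite mulr_gt0 ?f0|rewrite lnM ?posrE ?f0 // pE].
Qed.

Section UnivariateFekete.
Variable R : realType.
Implicit Types (W : {poly R}) (x : nat -> R).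

Definition replace x (i : nat) s (j : nat) : R := if j == i then s else x j.

Definition fekete_coef W n i x : R :=
  (\prod_(j < n | j != i :> nat) W.[x j]) *
  \prod_(j < n | j != i :> nat)
     \prod_(l < n | (l != j :> nat) && (l != i :> nat)) `|x j - x l|.

Definition fekete_poly W n i x : {poly R} :=
  W * \prod_(j < n | j != i :> nat) ('X - (x j)%:P) ^+ 2.

(** Each distance to the moving point occurs twice, and its square is a polynomial. Hence Markov's
    inequality applies to one coordinate at a time. *)
Lemma fekete_replace W n i x s : (i < n)%N ->
  fekete W n (replace x i s) = fekete_coef W n i x * (fekete_poly W n i x).[s].
Proof.
move=> ni; pose i' := Ordinal ni.
have ne (j : 'I_n) : (j != i') = (j != i :> nat) by rewrite -val_eqE.
have re (j : 'I_n) : j != i :> nat -> replace x i s j = x j by rewrite /replace => /negbTE->.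
have ri : replace x i s i = s by rewrite /replace eqxx.
rewrite /fekete (bigD1 i') //= ri.
rewrite (eq_bigl _ _ ne) (eq_bigr (fun j : 'I_n => W.[x j])); last by move=> j /re->.
rewrite [X in _ * X = _](bigD1 i') //= (eq_bigl _ _ ne) ri.
rewrite [X in _ * (X * _) = _](eq_bigr (fun j : 'I_n => `|s - x j|)); last by move=> j /re->.
rewrite [X in _ * (_ * X) = _](eq_bigr (fun j : 'I_n => `|s - x j| *
   \prod_(l < n | (l != j :> nat) && (l != i :> nat)) `|x j - x l|)); last first.
  move=> j ji; rewrite (bigD1 i') /=; last by rewrite eq_sym.
  rewrite ri re // distrC; congr (_ * _).
  rewrite (eq_bigl (fun l : 'I_n => (l != j :> nat) && (l != i :> nat))) => [|l]; last by rewrite ne.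
  by apply: eq_bigr => l /andP[_ li]; rewrite re.
have sq : \prod_(j < n | j != i :> nat) (('X - (x j)%:P) ^+ 2).[s] =
    (\prod_(j < n | j != i :> nat) `|s - x j|) * \prod_(j < n | j != i :> nat) `|s - x j|.
  rewrite -big_split; apply: eq_bigr => j _ /=.
  by rewrite horner_exp hornerXsubC -normrM -expr2 ger0_norm // sqr_ge0.
rewrite big_split /= /fekete_coef /fekete_poly hornerM horner_prod sq !(eq_bigl _ _ ne).
ring.
Qed.

Lemma replace_id x i : replace x i (x i) = x.
Proof. by apply/funext => j; rewrite /replace; case: eqP => [->|]. Qed.

Lemma size_fekete_poly W n i x :
  (size (fekete_poly W n i x) <= size W + n.*2)%N.
Proof.
have sp : (size (\prod_(j < n | j != i :> nat) ('X - (x j)%:P) ^+ 2)%R <= n.*2.+1)%N.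
  apply: leq_trans (size_poly_prod_leq _ _) _.
  set S := (\sum_(j < n | _) _)%N; set cc := #|_|.
  suff : (S <= cc * 3)%N /\ (cc <= n)%N by lia.
  split; last by rewrite -[leqRHS](card_ord n) max_card.
  rewrite -sum_nat_const; apply: leq_sum => j _.
  by rewrite (leq_trans (size_poly_exp_leq _ _)) // size_XsubC.
apply: leq_trans (size_polyMleq _ _) _; move: sp.
move: (size W) (size (\prod_(j < n | j != i :> nat) ('X - (x j)%:P) ^+ 2)%R) => u v; lia.
Qed.

End UnivariateFekete.

Section Spread.
Variables (R : realType) (W : {poly R}) (n N : nat) (h : R).
Hypotheses (W0 : forall t, 0 <= W.[t]) (n0 : (0 < n)%N).
Hypothesis sizeN : (size W + n.*2 <= N.+1)%N.
Local Notation A := (4 * N.+1%:R ^+ 3 : R).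
Hypotheses (h0 : 0 < h) (hA : 8 * A * n%:R * h <= 1).
Hypothesis m0 : 0 < fekete_max W n.

Section Points.
Variable x : nat -> R.
Hypotheses (hx : unit_points n x) (Fx : fekete_max W n / 2 < fekete W n x).

Let F0 : 0 < fekete W n x.
Proof. by apply: lt_trans Fx; rewrite divr_gt0. Qed.

Let A0 : 0 < A. Proof. by rewrite mulr_gt0 // exprn_gt0. Qed.



(** Markov's inequality in the [i]-th coordinate, where the polynomial is bounded by
    [fekete_max W n]; near-maximality replaces this bound by [2 * fekete W n x] and makes the loss
    relative. *)
Lemma fekete_replace_ge i s : (i < n)%N -> 0 <= s <= 1 ->
  fekete W n x * (1 - 2 * A * `|s - x i|) <= fekete W n (replace x i s).
Proof.
move=> ni s01.
have up t : 0 <= t <= 1 -> unit_points n (replace x i t).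
  by move=> t01 j nj; rewrite /replace; case: eqP => // _; apply: hx.
pose p := (fekete_coef W n i x) *: fekete_poly W n i x.
have pE t : p.[t] = fekete W n (replace x i t) by rewrite hornerZ fekete_replace.
have bp t : 0 <= t <= 1 -> `|p.[t]| <= fekete_max W n.
  move=> t01; rewrite pE ger0_norm ?fekete_ge0 //.
  by apply: fekete_le_max => //; exact: up.
have sp : (size p <= N.+1)%N.
  apply: leq_trans (size_scale_leq _ _) _.
  exact: leq_trans (size_fekete_poly _ _ _ _) sizeN.
have := poly_lipschitz sp bp s01 (hx ni).
rewrite !pE replace_id ler_norml => /andP[lb _].
have : A * fekete_max W n * `|s - x i| <= A * (2 * fekete W n x) * `|s - x i|.
  rewrite ler_wpM2r // ler_pM2l //; move: Fx; lra.
move: lb; set FF := fekete W n x; set G := fekete W n _; set MM := fekete_max W n.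
set u := `|s - x i|; move: (A) => a; lra.
Qed.

(** Moving [x i] onto [x j] makes the product vanish, so the relative loss must reach 1. *)
Lemma fekete_separated i j : (i < n)%N -> (j < n)%N -> i != j ->
  1 <= 2 * A * `|x i - x j|.
Proof.
move=> ni nj ij; have := fekete_replace_ge ni (hx nj).
have -> : fekete W n (replace x i (x j)) = 0.
  rewrite fekete_replace // /fekete_poly hornerM horner_prod.
  rewrite (bigD1 (Ordinal nj)) /= 1?eq_sym // horner_exp hornerXsubC subrr expr0n /=.
  by rewrite mul0r !mulr0.
by rewrite distrC pmulr_rle0 // subr_le0.
Qed.

Lemma fekete_dist_gt0 i j : (i < n)%N -> (j < n)%N -> i != j -> 0 < `|x i - x j|.
Proof.
move=> ni nj ij; have := fekete_separated ni nj ij.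
rewrite normr_gt0; apply: contraTneq => ->; rewrite normr0 mulr0.
by rewrite -ltNge ltr01.
Qed.

Lemma weight_gt0 i : (i < n)%N -> 0 < W.[x i].
Proof.
move=> ni; rewrite lt_neqAle W0 andbT eq_sym; apply: contraTneq F0 => Wi.
by rewrite /fekete (bigD1 (Ordinal ni)) //= Wi !mul0r ltxx.
Qed.

Lemma small_h : 4 * n%:R * h * (2 * A) <= 1.
Proof. by move: hA; move: (A) (n%:R) => a k; lra. Qed.

(** The bound [hA] on [h] is tuned for this: moving a point by [h] then changes its distance to any
    other point by a fraction of at most 1/(4n). *)
Lemma dist_le_sep i j : (i < n)%N -> (j < n)%N -> i != j ->
  4 * n%:R * h <= `|x i - x j|.
Proof.
move=> ni nj ij; have sep := fekete_separated ni nj ij.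
have A2 : 0 < 2 * A by rewrite mulr_gt0.
rewrite -(ler_pM2r A2); apply: le_trans small_h _.
by rewrite mulrC.
Qed.

(** Moving [x i] by at most [h] costs the product at most a quarter, while the squared distances to
    the other points grow by at most a factor 2. So the weight keeps at least 3/8 of its value, more
    than 1/3. *)
Lemma weight_near i s : (i < n)%N -> 0 <= s <= 1 -> `|s - x i| <= h ->
  W.[x i] <= 3 * W.[s].
Proof.
move=> ni s01 si.
have F34 : 3 / 4 * fekete W n x <= fekete W n (replace x i s).
  apply: le_trans (fekete_replace_ge ni s01).
  rewrite mulrC ler_pM2l //.
  have : 2 * A * `|s - x i| <= 2 * A * h by rewrite ler_pM2l // mulr_gt0.
  have : 4 * (h * (2 * A)) <= 4 * n%:R * h * (2 * A).
    rewrite -!mulrA ler_pM2l // ler_peMl ?ler1n // mulr_ge0 // ?ltW // mulr_gt0 //.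
  move: small_h; move: (4 * n%:R * h * (2 * A)) (A) => T a; lra.
have c0 : 0 < fekete_coef W n i x.
  have E : fekete W n x = fekete_coef W n i x * (fekete_poly W n i x).[x i].
    by rewrite -fekete_replace // replace_id.
  have q0 : 0 <= (fekete_poly W n i x).[x i].
    rewrite /fekete_poly hornerM mulr_ge0 // horner_prod prodr_ge0 // => j _.
    by rewrite horner_exp sqr_ge0.
  rewrite ltNge; apply: contraTN F0 => c0.
  by rewrite -leNgt E mulr_le0_ge0.
have : 3 / 4 * (fekete_poly W n i x).[x i] <= (fekete_poly W n i x).[s].
  rewrite -(ler_pM2l c0) -fekete_replace // mulrCA -fekete_replace // replace_id //.
rewrite /fekete_poly !hornerM !horner_prod.
set pi := \prod_(j < n | _) _; set ps := \prod_(j < n | _) _.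
have pi0 : 0 < pi.
  rewrite prodr_gt0 // => j ji; rewrite horner_exp hornerXsubC -real_normK ?num_real //.
  by rewrite exprn_gt0 // fekete_dist_gt0 // eq_sym.
have ps_le : ps <= 2 * pi.
  have pj (j : 'I_n) : j != i :> nat ->
      (('X - (x j)%:P) ^+ 2).[s] <= (1 + (4 * n%:R)^-1) ^+ 2 * (('X - (x j)%:P) ^+ 2).[x i].
    move=> ji; rewrite !horner_exp !hornerXsubC -exprMn.
    rewrite -(@real_normK _ (s - x j)) ?num_real // -(@real_normK _ (_ * _)) ?num_real //.
    rewrite lerXn2r ?nnegrE // normrM.
    have ij : i != j by rewrite eq_sym.
    have := dist_le_sep ni (ltn_ord j) ij.
    have n4 : 0 < 4 * n%:R :> R by rewrite mulr_gt0 // ltr0n.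
    rewrite mulrC -ler_pdivlMr // => hd.
    rewrite [X in _ <= X * _]ger0_norm; last by rewrite addr_ge0 // invr_ge0 ltW.
    have -> : s - x j = (s - x i) + (x i - x j) by ring.
    apply: le_trans (ler_normD _ _) _.
    rewrite mulrDl mul1r addrC lerD2l mulrC.
    exact: le_trans si hd.
  (* At most [n] factors, each increased by at most (1 + 1/(4n))^2, give at most exp (1/2), which is
     at most 2. *)
  apply: (@le_trans _ _ (\prod_(j < n | j != i :> nat)
      ((1 + (4 * n%:R)^-1) ^+ 2 * (('X - (x j)%:P) ^+ 2).[x i]))).
    by apply: ler_prod => j ji; rewrite horner_exp sqr_ge0 -horner_exp pj.
  rewrite big_split /= -/pi ler_pM2r // prodr_const.
  set cc := #|_|; have ccn : (cc <= n)%N by rewrite -[leqRHS](card_ord n) max_card.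
  rewrite -exprM.
  have n4 : 0 < 4 * n%:R :> R by rewrite mulr_gt0 // ltr0n.
  apply: (@le_trans _ _ (expR ((4 * n%:R)^-1) ^+ (2 * cc))).
    by rewrite lerXn2r ?nnegrE ?expR_ge0 ?expR_ge1Dx // addr_ge0 // invr_ge0 ltW.
  rewrite -expRM_natl; apply: (@le_trans _ _ (expR (2^-1))).
    rewrite ler_expR ler_pdivrMr // natrM.
    have : cc%:R <= n%:R :> R by rewrite ler_nat.
    move: (cc%:R) (n%:R) => u v; lra.
  rewrite -[expR _]invrK -expRN -[leRHS]invrK lef_pV2 ?posrE ?invr_gt0 ?expR_gt0 //.
  by have := @expR_ge1Dx R (- 2^-1); lra.
move=> h1.
have h2 : W.[s] * ps <= W.[s] * (2 * pi) by rewrite ler_wpM2l.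
have h3 : W.[x i] * pi <= (3 * W.[s]) * pi.
  move: h1 h2; have := mulr_ge0 (W0 s) (ltW pi0).
  by move: (W.[s]) (W.[x i]) => Ws Wi; lra.
by rewrite ler_pM2r in h3.
Qed.

Lemma ln_weight_near i s : (i < n)%N -> 0 <= s <= 1 -> `|s - x i| <= h ->
  0 < W.[s] /\ - ln W.[s] <= - ln W.[x i] + 2.
Proof.
move=> ni s01 si; have Wi := weight_gt0 ni; have Wn := weight_near ni s01 si.
have Ws : 0 < W.[s] by move: Wi Wn; lra.
split=> //; have : ln W.[x i] <= ln (3 * W.[s]) by rewrite ler_ln ?posrE // mulr_gt0.
rewrite lnM ?posrE //.
have : ln (3 : R) <= 2.
  by have := @le_ln1Dx R 2; rewrite (_ : 1 + 2 = 3); [apply; lra|ring].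
lra.
Qed.

(** The two displacements together are at most [|x i - x j| / (2 n)]. A loss of 1/n per pair adds up
    to O(n) over all pairs, within the error term. *)
Lemma ln_dist_near i j s t : (i < n)%N -> (j < n)%N -> i != j ->
  `|s - x i| <= h -> `|t - x j| <= h ->
  0 < `|s - t| /\ - ln `|s - t| <= - ln `|x i - x j| + n%:R^-1.
Proof.
move=> ni nj ij si tj.
have nR0 : 0 < n%:R :> R by rewrite ltr0n.
have sep := dist_le_sep ni nj ij.
set d := `|x i - x j| in sep *; have d0 : 0 < d by apply: fekete_dist_gt0.
pose v : R := n%:R^-1; have v0 : 0 < v by rewrite invr_gt0.
have v1 : v <= 1 by rewrite invf_le1 ?ler1n.
have hd : 2 * h <= d * (v / 2).
  rewrite mulrA ler_pdivlMr // ler_pdivlMr //.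
  move: sep; lra.
have low : d * (1 - v / 2) <= `|s - t|.
  have : d <= `|s - t| + `|s - x i| + `|t - x j|.
    rewrite /d (_ : x i - x j = (s - t) - (s - x i) + (t - x j)); last by ring.
    by apply: le_trans (ler_normD _ _) _; rewrite lerD2r; exact: ler_normB.
  rewrite mulrBr mulr1; move: hd si tj.
  by set z := d * (v / 2); lra.
(* For 0 < v <= 1 the product (1 - v/2)(1 + v) is at least 1, so exp (- v) <= 1/(1 + v) <= 1 -
   v/2. *)
have e : d * expR (- v) <= `|s - t|.
  apply: le_trans low; rewrite ler_pM2l // expRN.
  have p : 0 < 1 - v / 2 by lra.
  rewrite -[leRHS]invrK lef_pV2 ?posrE ?invr_gt0 ?expR_gt0 //.
  apply: le_trans (expR_ge1Dx v); rewrite -div1r ler_pdivrMr //.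
  nra.
have e0 : 0 < d * expR (- v) by rewrite mulr_gt0 // expR_gt0.
split; first exact: lt_le_trans e.
have : ln (d * expR (- v)) <= ln `|s - t| by rewrite ler_ln ?posrE // (lt_le_trans e0).
by rewrite lnM ?posrE ?expR_gt0 // expRK -/v; lra.
Qed.

Lemma ln_fekete : ln (fekete W n x) =
  \sum_(i < n) ln W.[x i] + \sum_(i < n) \sum_(j < n | j != i :> nat) ln `|x i - x j|.
Proof.
have d0 (i j : 'I_n) : j != i :> nat -> 0 < `|x i - x j|.
  by move=> ji; apply: fekete_dist_gt0 => //; rewrite eq_sym.
rewrite /fekete lnM ?posrE.
- rewrite !ln_prod.
  + by congr (_ + _); apply: eq_bigr => i _; rewrite ln_prod // => j; exact: d0.
  + by move=> i _; apply: prodr_gt0 => j; exact: d0.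
  + by move=> i _; exact: weight_gt0.
- by apply: prodr_gt0 => i _; exact: weight_gt0.
- by apply: prodr_gt0 => i _; apply: prodr_gt0 => j; exact: d0.
Qed.

Lemma ln_fekete_ge : ln (fekete_max W n) - 1 <= ln (fekete W n x).
Proof.
have : ln (fekete_max W n / 2) <= ln (fekete W n x).
  by rewrite ler_ln ?posrE ?divr_gt0 // ltW.
rewrite lnM ?posrE ?invr_gt0 // lnV ?posrE //.
have : ln (2 : R) <= 1.
  by have := @le_ln1Dx R 1; rewrite (_ : 1 + 1 = 2); [apply; lra|ring].
lra.
Qed.

End Points.

End Spread.

(** * Summing over geometric scales *)

(* The loss [A] per scale is absorbed because consecutive scales shrink by [ga / be < 1]. *)
Lemma growth_step (F : realFieldType) (be ga K A C c1 N n m l : F) :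
  1 <= ga -> be = ga + 1 -> 0 <= K -> 0 <= C -> 0 <= c1 ->
  A = 2 * C + 4 * K * be * (c1 + be) -> 2 * be * c1 + c1 + be + 1 <= N ->
  0 <= l -> 0 <= n -> be * n <= N - c1 -> N - c1 - be < be * n ->
  ga * n <= m -> m <= ga * n + c1 ->
  K * N ^+ 2 - A * N * (1 + l) <=
  K * m ^+ 2 - A * m * (1 + l) + (K * (be ^+ 2 - ga ^+ 2) * n ^+ 2 - C * n * (1 + l)).
Proof.
move=> ga1 beE K0 C0 c10 AE XN l0 n0 nN Nn gm mg.
have ga0 : 0 < ga by lra.
have be0 : 0 < be by lra.
have bc0 : 0 <= be * c1 by rewrite mulr_ge0 // ltW.
have gc0 : 0 <= ga * c1 by rewrite mulr_ge0 // ltW.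
have N0 : 0 <= N by lra.
have A0 : 0 <= A by rewrite AE addr_ge0 // !mulr_ge0 // ?addr_ge0 // ?ltW.
have h1 : K * (ga * n) ^+ 2 <= K * m ^+ 2.
  rewrite ler_wpM2l // lerXn2r ?nnegrE ?(mulr_ge0 (ltW ga0) n0) //.
  by apply: le_trans gm; rewrite mulr_ge0 // ltW.
have h2 : K * N ^+ 2 - 2 * K * (c1 + be) * N <= K * (be * n) ^+ 2.
  have h : N ^+ 2 - 2 * (c1 + be) * N <= (be * n) ^+ 2.
    have p : 0 <= N - c1 - be by lra.
    apply: (@le_trans _ _ ((N - c1 - be) ^+ 2)).
      by have := sqr_ge0 (c1 + be); lra.
    by rewrite lerXn2r ?nnegrE ?(mulr_ge0 (ltW be0) n0) // ltW.
  by have := ler_wpM2l K0 h; lra.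
have h3 : A * m + 2 * K * (c1 + be) * N + C * n <= A * N.
  have d : N <= 2 * be * (N - m).
    have i1 : be * m <= be * (ga * n + c1) by rewrite ler_pM2l.
    have i2 : ga * (be * n) <= ga * (N - c1) by rewrite ler_pM2l.
    have i3 : be * N = ga * N + N by rewrite beE; ring.
    have i4 : be * (ga * n + c1) = ga * (be * n) + be * c1 by ring.
    lra.
  have d2 : A * N <= A * (2 * be * (N - m)) by rewrite ler_wpM2l.
  have d3 : 2 * be * (2 * K * (c1 + be) * N + C * n) <= A * N.
    have j1 : C * (be * n) <= C * (N - c1) by rewrite ler_wpM2l.
    have j2 := mulr_ge0 C0 c10.
    rewrite AE; lra.
  have d4 : 2 * be * (2 * K * (c1 + be) * N + C * n) <= 2 * be * (A * (N - m)).
    apply: le_trans d3 _; apply: le_trans d2 _; rewrite le_eqVlt; apply/orP; left; apply/eqP; ring.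
  have be2 : 0 < 2 * be by rewrite mulr_gt0.
  by move: d4; rewrite ler_pM2l //; lra.
have l1 : 0 <= 1 + l by rewrite addr_ge0.
have h4 := ler_wpM2r l1 h3.
have h5 : 2 * K * (c1 + be) * N <= 2 * K * (c1 + be) * N * (1 + l).
  by rewrite ler_peMr ?lerDl // !mulr_ge0 // addr_ge0 // ltW.
rewrite !exprMn in h1 h2.
lra.
Qed.

Lemma scale_index n D N : (0 < n)%N -> (2 * n + D <= N.+1)%N ->
  [/\ (n + D < N.+1)%N, ((n + D).-1 < N)%N & (n + D).-1.+1 = (n + D)%N].
Proof. by move=> n0 h; split; lia. Qed.

Lemma growth (F : realType) (S : nat -> F) (V al c1 C : F) :
  (forall n, 0 <= S n) -> (forall m n, (m <= n)%N -> S m <= S n) ->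
  0 <= V -> 0 <= al -> 0 <= c1 -> 0 <= C ->
  (forall n, (0 < n)%N -> exists D : nat,
    [/\ 2 * al * n%:R <= D%:R, D%:R <= 2 * al * n%:R + c1 &
     V * n%:R ^+ 2 - C * n%:R * (1 + ln n%:R) <= S (2 * n + D)%N - S (n + D)%N]) ->
  exists A B : F, [/\ 0 <= A, 0 <= B & forall N,
    V / (4 * al + 3) * N.+1%:R ^+ 2 - A * N.+1%:R * (1 + ln N.+1%:R) - B <= S N.+1].
Proof.
move=> S0 Sle V0 al0 c10 C0 step.
pose be : F := 2 + 2 * al; pose ga : F := 1 + 2 * al; pose K := V / (4 * al + 3).
pose A := 2 * C + 4 * K * be * (c1 + be); pose X1 := 2 * be * c1 + c1 + be + 1.
have ga1 : 1 <= ga by rewrite /ga; lra.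
have be0 : 0 < be by rewrite /be; lra.
have beE : be = ga + 1 by rewrite /be /ga; ring.
have K0 : 0 <= K by rewrite divr_ge0 // addr_ge0 // mulr_ge0.
have A0 : 0 <= A.
  have h : 0 <= c1 + be by rewrite addr_ge0 // ltW.
  have h' := mulr_ge0 (mulr_ge0 (ler0n F 4) K0) (ltW be0).
  by apply: addr_ge0; [rewrite mulr_ge0|exact: mulr_ge0].
have bc0 : 0 <= be * c1 by rewrite mulr_ge0 // ltW.
(* The difference of squares is [4 * al + 3], which is the origin of the denominator. *)
have VE : V = K * (be ^+ 2 - ga ^+ 2).
  have h : 4 * al + 3 != 0 by rewrite gt_eqF //; lra.
  by rewrite /K /be /ga; field.
exists A, (K * X1 ^+ 2); split=> //; first by rewrite mulr_ge0 // sqr_ge0.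
move=> N; rewrite -/K; elim/ltn_ind: N => N IH.
have ln0 (k : nat) : 0 <= ln (k.+1%:R : F) by rewrite ln_ge0 // ler1n.
(* Below the threshold [X1] the constant [K * X1 ^+ 2] already makes the left-hand side
   nonpositive. *)
have [XN|NX] := leP X1 N.+1%:R; last first.
  apply: le_trans (S0 _).
  have : K * N.+1%:R ^+ 2 <= K * X1 ^+ 2.
    rewrite ler_wpM2l // lerXn2r ?nnegrE ?ler0n // ?(ltW NX) //.
    exact: le_trans (ltW NX).
  have : 0 <= A * N.+1%:R * (1 + ln N.+1%:R) by rewrite !mulr_ge0 // addr_ge0.
  lra.
(* The largest [n] with [be * n + c1 <= N + 1], which guarantees [2 n + D <= N + 1]; the induction
   hypothesis is used at [n + D]. *)
pose n := Num.truncn ((N.+1%:R - c1) / be).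
have q0 : 0 <= (N.+1%:R - c1) / be.
  by apply: divr_ge0; [move: XN; rewrite /X1; lra|exact: ltW].
have n1 : n%:R <= (N.+1%:R - c1) / be by rewrite truncn_le.
have n2 : (N.+1%:R - c1) / be < n.+1%:R by exact: truncnS_gt.
have nN : be * n%:R <= N.+1%:R - c1 by rewrite mulrC -ler_pdivlMr.
have Nn : N.+1%:R - c1 - be < be * n%:R.
  by move: n2; rewrite ltr_pdivrMr // -natr1; lra.
have npos : (0 < n)%N.
  rewrite -(ltr_nat F) -(pmulr_rgt0 _ be0); apply: le_lt_trans Nn.
  by move: XN; rewrite /X1; lra.
have [D [D1 D2 hD]] := step n npos.
have le1 : (2 * n + D <= N.+1)%N.
  rewrite -(ler_nat F) natrD natrM; move: nN D2; rewrite /be; lra.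
have [lt2 lt3 e3] := scale_index npos le1.
have := IH _ lt3; rewrite e3 => IHm.
have nD0 : (0 < n + D)%N by rewrite addn_gt0 npos.
have lnm : ln ((n + D)%:R : F) <= ln (N.+1%:R : F).
  by rewrite ler_ln ?posrE ?ltr0n ?ler_nat //; exact: ltnW.
have nN1 : (n <= N.+1)%N by apply: leq_trans (ltnW lt2); exact: leq_addr.
have lnn : ln (n%:R : F) <= ln (N.+1%:R : F).
  by rewrite ler_ln ?posrE ?ltr0n ?ler_nat.
have m1 : A * (n + D)%:R * (1 + ln (n + D)%:R) <= A * (n + D)%:R * (1 + ln N.+1%:R).
  by rewrite ler_wpM2l ?mulr_ge0 // lerD2l.
have m2 : C * n%:R * (1 + ln n%:R) <= C * n%:R * (1 + ln N.+1%:R).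
  by rewrite ler_wpM2l ?mulr_ge0 // lerD2l.
have Smono := Sle _ _ le1.
have g1 : ga * n%:R <= (n + D)%:R by rewrite natrD /ga; move: D1; lra.
have g2 : (n + D)%:R <= ga * n%:R + c1 by rewrite natrD /ga; move: D2; lra.
have := growth_step ga1 beE K0 C0 c10 (erefl A) XN (ln0 N) (ler0n _ n) nN Nn g1 g2.
rewrite -VE; move: IHm m1 m2 Smono hD.
move: (K * N.+1%:R ^+ 2) (K * (n + D)%:R ^+ 2) (V * n%:R ^+ 2) (K * X1 ^+ 2) => t1 t2 t3 t4.
move: (A * (n + D)%:R * (1 + ln (n + D)%:R)) (A * (n + D)%:R * (1 + ln N.+1%:R)) => t5 t6.
move: (C * n%:R * (1 + ln n%:R)) (C * n%:R * (1 + ln N.+1%:R)) => t7 t8.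
lra.
Qed.

(** Once ln x >= 1, each of 1, x and x ln x is at most x ln^2 x, which absorbs the rounding of [x]
    and all lower-order terms. *)
Lemma growth_real (F : realType) (K A B x : F) (N : nat) :
  0 <= K -> 0 <= A -> 0 <= B -> 1 <= ln x -> 0 < x -> N.+1%:R <= x < N.+2%:R ->
  K * x ^+ 2 - (2 * K + 2 * A + B) * (x * ln x ^+ 2) <=
  K * N.+1%:R ^+ 2 - A * N.+1%:R * (1 + ln N.+1%:R) - B.
Proof.
move=> K0 A0 B0 lx x0 /andP[Nx xN].
have N1 : 1 <= N.+1%:R :> F by rewrite ler1n.
have x1 : 1 <= x by apply: le_trans Nx.
have lN : ln N.+1%:R <= ln x by rewrite ler_ln ?posrE ?ltr0n.
have l2 : 1 <= ln x ^+ 2 by rewrite -(expr1n _ 2) lerXn2r ?nnegrE ?(le_trans _ lx).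
have ll2 : ln x <= ln x ^+ 2 by rewrite expr2 ler_peMr // (le_trans _ lx).
have xl : x <= x * ln x ^+ 2 by rewrite ler_peMr // ltW.
have xl' : x * ln x <= x * ln x ^+ 2 by rewrite ler_pM2l.
have h1 : K * x ^+ 2 - 2 * K * (x * ln x ^+ 2) <= K * N.+1%:R ^+ 2.
  have s : x ^+ 2 - 2 * x <= N.+1%:R ^+ 2.
    apply: (@le_trans _ _ ((x - 1) ^+ 2)); first by lra.
    rewrite lerXn2r ?nnegrE ?subr_ge0 //.
    by move: xN; rewrite -(natr1 N.+1); lra.
  have s1 := ler_wpM2l K0 s.
  have s2 := ler_wpM2l K0 xl.
  lra.
have h2 : A * N.+1%:R * (1 + ln N.+1%:R) <= 2 * A * (x * ln x ^+ 2).
  apply: (@le_trans _ _ (A * x * (1 + ln x))).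
    rewrite -!mulrA ler_wpM2l // ler_pM // ?addr_ge0 ?ln_ge0 //.
    by rewrite lerD2l.
  have s1 := ler_wpM2l A0 xl; have s2 := ler_wpM2l A0 xl'.
  lra.
have h3 : B <= B * (x * ln x ^+ 2) by rewrite ler_peMr // (le_trans x1).
lra.
Qed.

Local Open Scope classical_set_scope.
Local Open Scope ring_scope.
Local Notation R := RbaseSymbolsImpl_R__canonical__reals_Real.
Local Notation RM := (measurableTypeR R).
Local Notation Rlt := Rdefinitions.Rlt.

(** * The Chebyshev function and least common multiples *)


(** The least common multiple of 1, ..., m, written through its maximal prime powers so that its
    logarithm is visibly psi(m). *)
Definition lcm_upto (m : nat) : nat := (\prod_(0 <= p < m.+1 | prime p) p ^ trunc_log p m)%N.

Lemma lcm_upto_gt0 m : (0 < lcm_upto m)%N.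
Proof. by apply: prodn_cond_gt0 => p pp; rewrite expn_gt0 prime_gt0. Qed.

Lemma dvdn_lcm_upto k m : (0 < k <= m)%N -> (k %| lcm_upto m)%N.
Proof.
move=> /andP[k0 km].
apply/dvdn_partP => // p pk; have pp : prime p by move: pk; rewrite mem_primes => /andP[].
rewrite p_part.
have pkm : (p ^ logn p k <= m)%N.
  by apply: leq_trans km; apply: dvdn_leq => //; exact: pfactor_dvdnn.
have pm : (p < m.+1)%N.
  by rewrite ltnS; apply: leq_trans km; apply: dvdn_leq => //; move: pk; rewrite mem_primes => /and3P[].
apply: (@dvdn_trans (p ^ trunc_log p m)).
  by apply: dvdn_exp2l; apply: trunc_log_max => //; exact: prime_gt1.
rewrite /lcm_upto big_mkord (bigD1 (Ordinal pm)) //=.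
exact: dvdn_mulr.
Qed.

Lemma Zprime_prime p : Znumtheory.prime (BinInt.Z.of_nat p) <-> prime p.
Proof.
split=> [Zp|pp].
  apply/primeP; split; first by have := Znumtheory.prime_ge_2 _ Zp; lia.
  move=> d /dvdnP[q e].
  have dZ : BinInt.Z.divide (BinInt.Z.of_nat d) (BinInt.Z.of_nat p).
    by exists (BinInt.Z.of_nat q); lia.
  by have := Znumtheory.prime_divisors _ Zp _ dZ; lia.
apply/Znumtheory.prime_alt; split; first by have := prime_gt1 pp; lia.
move=> n n1p [q e].
have dn : (BinInt.Z.to_nat n %| p)%N.
  by apply/dvdnP; exists (BinInt.Z.to_nat q); nia.
by move: pp => /primeP[_ /(_ _ dn)]; lia.
Qed.

Lemma fold_right_sum (f : nat -> R) a k :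
  List.fold_right Rdefinitions.RbaseSymbolsImpl.Rplus (Rdefinitions.IZR BinNums.Z0)
    (List.map f (List.seq a k)) = \sum_(a <= i < a + k) f i.
Proof.
elim: k a => [|k IH] a /=; first by rewrite addn0 big_geq.
by rewrite IH RplusE addnS -addSn [RHS]big_ltn // ltnS leq_addr.
Qed.

Lemma up_nat (x : R) m : m%:R <= x < m.+1%:R -> BinInt.Z.to_nat (Rdefinitions.up x) = m.+1.
Proof.
move=> /andP[/RleP mx /RltP xm].
have -> : Rdefinitions.up x = BinInt.Z.of_nat m.+1; last by rewrite Znat.Nat2Z.id.
apply/esym/R_Ifp.tech_up.
  by rewrite -RIneq.INR_IZR_INZ INRE.
rewrite -RIneq.INR_IZR_INZ INRE -natr1 RplusE; apply/RleP; rewrite lerD2r; exact/RleP.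
Qed.

(** For a prime p the inner sum counts the exponents j >= 1 with p^j <= m, and [trunc_log p m] is
    their number. *)
Lemma psi_lcm (x : R) m : m%:R <= x < m.+1%:R -> Defs.psi x = ln (lcm_upto m)%:R.
Proof.
move=> mx; rewrite /Defs.psi (up_nat mx) fold_right_sum add0n.
have powle p j : (Rdefinitions.Rle (Rpow_def.pow (Raxioms.INR p) j) x) <-> (p ^ j <= m)%N.
  rewrite INRE RpowE -natrX; split.
    move=> /RleP h; rewrite -ltnS -(ltr_nat R); apply: le_lt_trans h _; by case/andP: mx.
  by move=> h; apply/RleP; apply: le_trans (andP mx).1; rewrite ler_nat.
have inner p : List.fold_right Rdefinitions.RbaseSymbolsImpl.Rplus (Rdefinitions.IZR BinNums.Z0)
    (List.map (fun m0 : nat =>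
      match Znumtheory.prime_dec (BinInt.Z.of_nat p) with
      | left _ => match RIneq.Rle_dec (Rpow_def.pow (Raxioms.INR p) m0) x with
                  | left _ => Rpower.ln (Raxioms.INR p)
                  | right _ => Rdefinitions.IZR BinNums.Z0
                  end
      | right _ => Rdefinitions.IZR BinNums.Z0
      end) (List.seq 1 m.+1)) =
    if prime p then ln (p%:R : R) *+ trunc_log p m else 0.
  rewrite fold_right_sum.
  case: Znumtheory.prime_dec => [Zp|np] /=; last first.
    by rewrite big1 //; case: ifP => // pp; case: np; exact/Zprime_prime.
  have pp : prime p by exact/Zprime_prime.
  have p1 := prime_gt1 pp.
  have Tm : (trunc_log p m <= m)%N.
    have [->|m0] := posnP m; first by rewrite trunc_log0.
    by apply: leq_trans (trunc_logP p1 m0); exact/ltnW/ltn_expl.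
  rewrite pp (eq_big_nat _ _ (F2 := fun j => if (j < (trunc_log p m).+1)%N then ln (p%:R : R) else 0)); last first.
    move=> j /andP[j0 _].
    have -> : (j < (trunc_log p m).+1)%N = (p ^ j <= m)%N.
      rewrite ltnS; apply/idP/idP => [jT|]; last exact: trunc_log_max.
      have m0 : (0 < m)%N.
        by rewrite lt0n; apply: contraTneq jT => ->; rewrite trunc_log0 -ltnNge.
      by apply: leq_trans (trunc_logP p1 m0); rewrite leq_exp2l.
    case: RIneq.Rle_dec => [/powle ->|h] /=; first by rewrite INRE RlnE.
    by case: ifP => // pj; case: h; exact/powle.
  have -> : ln (p%:R : R) *+ trunc_log p m = \sum_(1 <= i < (trunc_log p m).+1) ln (p%:R : R).
    by rewrite sumr_const_nat subn1.
  by rewrite [RHS](big_nat_widen _ _ (1 + m.+1)%N) ?add1n ?ltnS 1?leqW // [RHS]big_mkcond.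
(* The outer range of [psi] also contains [p = m + 1], whose term vanishes because its truncated
   logarithm is 0. *)
rewrite (eq_bigr _ (fun p _ => inner p)) big_nat_recr //= (_ : trunc_log m.+1 m = 0%N); last first.
  by apply/eqP; rewrite trunc_log_eq0; lia.
rewrite mulr0n if_same addr0 /lcm_upto natr_prod ln_prod; last first.
  by move=> p pp; rewrite ltr0n expn_gt0 prime_gt0.
rewrite [RHS]big_mkcond; apply: eq_bigr => p _ /=; case: ifP => // pp.
by rewrite natrX lnXn // ltr0n prime_gt0.
Qed.

(** * Lebesgue integration against Borel probability measures *)

(** Both sides are smallest sigma-algebras, generated by bounded open intervals and by open rays; a
    ray is a countable union of bounded intervals. *)
Lemma borel_measurable (A : set RM) : Defs.borel A <-> measurable A.
Proof.
split=> [|mA].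
  apply; first split; first exact: measurableT.
    split=> [B mB|F mF]; first exact: measurableC.
    have -> : (fun x => exists n, F n x) = \bigcup_n F n.
      by apply/seteqP; split=> x [n]; exists n.
    exact: bigcupT_measurable.
  move=> a b; have -> : (fun x => Rlt a x /\ Rlt x b) = `]a, b[%classic :> set RM.
    apply/seteqP; split=> x /=; rewrite in_itv /=.
      by move=> [/RltP -> /RltP ->].
    by move=> /andP[/RltP ? /RltP ?].
  exact: measurable_itv.
move=> S [ST [SC SU]] Sitv.
have Sigma : sigma_algebra [set: R] S.
  split=> [|B SB|F SF].
  - have -> : set0 = (fun x : R => ~ True) by apply/seteqP; split=> x // H; exact: H.
    exact: SC.
  - by rewrite setTD; exact: SC.
  - have -> : \bigcup_k F k = (fun x => exists n, F n x); last exact: SU.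
    by apply/seteqP; split=> x [n]; exists n.
have mA' : (@RGenOInfty.G R).-sigma.-measurable A by rewrite -RGenOInfty.measurableE.
apply: (smallest_sub Sigma _ mA') => _ [x ->].
have -> : `]x, +oo[%classic = (fun y => exists n : nat, Rlt x y /\ Rlt y (x + n%:R)).
  apply/seteqP; split=> y /=; rewrite in_itv /= andbT.
    move=> xy; exists (Num.truncn (y - x)).+1; split; apply/RltP => //.
    by rewrite -ltrBlDl truncnS_gt.
  by move=> [n [/RltP]].
by apply: SU => n; exact: Sitv.
Qed.

Definition real_measure (P : set RM -> \bar R) (A : R -> Prop) : R := fine (P A).

Definition ereal_of_ext (v : Defs.ext) : \bar R := if v is Some r then r%:E else +oo%E.

Definition ext_of_ereal (v : \bar R) : Defs.ext := if v is r%:E%E then Some r else None.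

Lemma ext_leP r v : Defs.ext_le r v <-> (r%:E <= ereal_of_ext v)%E.
Proof.
case: v => [y|] /=; last by rewrite leey.
by rewrite lee_fin; split=> /RleP.
Qed.

Section Probability.
Variable P : probability RM R.

Lemma real_measureK (A : set RM) : measurable A -> (real_measure P A)%:E = P A.
Proof. by move=> mA; rewrite fineK // fin_num_measure. Qed.

Lemma unit_measure_real_measure a b : P (~` `[a, b]%classic) = 0%E ->
  Defs.unit_measure_on a b (real_measure P).
Proof.
move=> Pab; split; [|split; [|split]].
- by move=> A _; apply/RleP; rewrite fine_ge0.
- by rewrite /real_measure (_ : (fun=> True) = setT) // probability_setT.
- move=> F bF disj.
  have mF n : measurable (F n : set RM) by apply/borel_measurable.
  have eU : (fun x => exists n, F n x) = \bigcup_n F n.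
    by apply/seteqP; split=> x [n]; exists n.
  have tF : trivIset setT F.
    move=> i j _ _ [x [Fi Fj]]; apply: contrapT => /eqP ij.
    exact: (disj i j x (elimN eqP ij)).
  have mU : measurable (\bigcup_n F n : set RM) by exact: bigcupT_measurable.
  have cv : (\sum_(0 <= i < n) real_measure P (F i)) @[n --> \oo] --> real_measure P (\bigcup_n F n).
    pose G : nat -> set RM := F.
    have := @measure_semi_sigma_additive _ _ _ P G mF tF mU.
    move=> cvE; have : (\sum_(0 <= i < n) P (G i))%E @[n --> \oo] -->
        (real_measure P (\bigcup_n F n))%:E.
      by rewrite (real_measureK mU); exact: cvE.
    move=> /fine_cvgP[_].
    suff -> : (fun n => \sum_(0 <= i < n) real_measure P (F i)) =
        fine \o (fun n => (\sum_(0 <= i < n) P (G i))%E) by [].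
    apply/funext => n /=; rewrite (eq_bigr (fun i => (real_measure P (F i))%:E)).
      by rewrite sumEFin.
    by move=> i _; rewrite real_measureK.
  rewrite eU => eps /RltP eps0.
  have /cvgrPdist_lt /(_ eps eps0) [N _ hN] := cv.
  exists N => n /ssrnat.leP nN; apply/RltP; rewrite RdistE sum_f_R0E distrC.
  by apply: hN => /=; exact: leqW.
- rewrite /real_measure (_ : (fun x => _) = ~` `[a, b]) ?Pab //.
  apply/seteqP; split=> x /= h; rewrite in_itv /= in h *.
    by move=> /andP[/RleP ? /RleP ?]; apply: h.
  by move=> [/RleP ax /RleP xb]; apply: h; rewrite ax xb.
Qed.

Lemma simple_val_measurable l : Defs.simple_ok l -> measurable_fun [set: RM] (Defs.simple_val l : RM -> R).
Proof.
elim: l => [|[c A] l IH] h; first exact: measurable_cst.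
inversion h as [|cA l' [_ bA] hl]; subst; move/borel_measurable: bA => mA.
have -> : Defs.simple_val ((c, A) :: l) = (fun x => c * \1_A x + Defs.simple_val l x).
  apply/funext => x; rewrite /= RplusE; congr (_ + _).
  rewrite indicE; case: ClassicalEpsilon.excluded_middle_informative => /= Ax.
    by rewrite mem_set // mulr1.
  by rewrite memNset // mulr0.
apply: measurable_funD; last exact: IH.
by apply: measurable_funM; [exact: measurable_cst|exact: measurable_indic].
Qed.

Lemma simple_val_ge0 l x : Defs.simple_ok l -> 0 <= Defs.simple_val l x.
Proof.
elim: l => [|[c A] l IH] h //=; inversion h as [|cA l' [c0' _] hl]; subst; move/RleP: c0' => /= c0.
rewrite RplusE addr_ge0 ?IH //.
by case: ClassicalEpsilon.excluded_middle_informative.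
Qed.

Lemma integral_simple_val l : Defs.simple_ok l ->
  (\int[P]_x (Defs.simple_val l x)%:E = (Defs.simple_int (real_measure P) l)%:E)%E.
Proof.
elim: l => [|[c A] l IH] h; first by rewrite /= integral0.
inversion h as [|cA l' [c0' bA] hl]; subst; move/RleP: c0' => /= c0.
have mA := (borel_measurable A).1 bA.
pose B : set RM := A.
pose sv : RM -> R := Defs.simple_val l.
rewrite (eq_integral (fun x : RM => (c%:E * (\1_B x)%:E + (sv x)%:E)%E)); last first.
  move=> x _; rewrite -EFinM -EFinD /= RplusE; congr ((_ + _)%:E).
  rewrite indicE; case: ClassicalEpsilon.excluded_middle_informative => /= Ax.
    by rewrite mem_set // mulr1.
  by rewrite memNset // mulr0.
have mind : measurable_fun [set: RM] (fun x : RM => (\1_B x)%:E : \bar R).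
  by apply/measurable_EFinP; exact: measurable_indic.
rewrite ge0_integralD //.
- rewrite ge0_integralZl //.
  by rewrite integral_indic // setIT IH //= EFinD EFinM real_measureK.
- by move=> x _; apply: mule_ge0; rewrite lee_fin.
- exact: measurable_funeM.
- by move=> x _; rewrite lee_fin; exact: simple_val_ge0.
- by apply/measurable_EFinP; exact: simple_val_measurable.
Qed.

Lemma lint_set_le_integral (g : R -> Defs.ext) r :
  (forall x, (0 <= ereal_of_ext (g x))%E) ->
  measurable_fun [set: RM] (fun x : RM => ereal_of_ext (g x)) ->
  Defs.lint_set (real_measure P) g r -> (r%:E <= \int[P]_x ereal_of_ext (g x))%E.
Proof.
move=> g0 mg [->|[l [ok [lg ->]]]]; first by apply: integral_ge0 => x _.
rewrite -integral_simple_val //; apply: ge0_le_integral => //.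
- by move=> x _; rewrite lee_fin simple_val_ge0.
- by apply/measurable_EFinP; exact: simple_val_measurable.
- by move=> x _; apply/ext_leP.
Qed.

(** A simple function is listed by its level sets, so its integral is one of the values in
    [lint_set]. *)
Lemma nnsfun_lint_set (g : R -> Defs.ext) (h : {nnsfun RM >-> R}) :
  (forall x, ((h x)%:E <= ereal_of_ext (g x))%E) ->
  exists2 r, sintegral P h = r%:E & Defs.lint_set (real_measure P) g r.
Proof.
move=> hg.
have fin : finite_set (range h) by exact: fimfunP.
pose s : seq R := finmap.enum_fset (fset_set (range h)).
pose l := [seq (y, (fun x => h x = y)) | y <- s].
have mh y : measurable (h @^-1` [set y] : set RM).
  exact: measurable_sfunP.
have sE : sintegral P h = (Defs.simple_int (real_measure P) l)%:E.
  rewrite sintegralE fsbig_finite //= /l -/s; elim: (s) => [|y s' IH] /=.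
    by rewrite big_nil.
  by rewrite big_cons IH RplusE RmultE EFinD EFinM real_measureK //; exact: mh.
exists (Defs.simple_int (real_measure P) l) => //; right; exists l; split; [|split=> //].
- rewrite /Defs.simple_ok /l.
  have s0 : {in s, forall y, 0 <= y}.
    by move=> y; rewrite in_fset_set // => /set_mem [x _ <-].
  elim: (s) s0 => [|y s' IH] s0 /=; constructor => /=.
    split; first by apply/RleP/s0; rewrite mem_head.
    by apply/borel_measurable; exact: mh.
  by apply: IH => z zs; apply: s0; rewrite in_cons zs orbT.
- move=> x; apply/ext_leP; suff -> : Defs.simple_val l x = h x by [].
  have us : uniq s by exact: finmap.fset_uniq.
  have hs : h x \in s by rewrite in_fset_set // inE; exists x.
  have -> : Defs.simple_val l x = \sum_(y <- s) (if h x == y then y else 0).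
    rewrite /l; elim: (s) => [|y s' IH] /=; first by rewrite big_nil.
    rewrite big_cons IH RplusE; congr (_ + _).
    by case: ClassicalEpsilon.excluded_middle_informative => [/eqP ->|/eqP /negbTE ->].
  rewrite (bigD1_seq (h x)) //= eqxx big1 ?addr0 // => y.
  by rewrite eq_sym => /negbTE->.
Qed.

(** Monotonicity bounds every value in [lint_set] by the integral, and the level-set lists approach
    it; an unbounded [lint_set] corresponds to an infinite integral. *)
Lemma lint_integral (g : R -> Defs.ext) :
  (forall x, (0 <= ereal_of_ext (g x))%E) ->
  measurable_fun [set: RM] (fun x : RM => ereal_of_ext (g x)) ->
  Defs.lint (real_measure P) g = ext_of_ereal (\int[P]_x ereal_of_ext (g x)).
Proof.
move=> g0 mg.
have ub r := @lint_set_le_integral g r g0 mg.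
have I0 : (0 <= \int[P]_x ereal_of_ext (g x))%E by apply: integral_ge0 => x _.
have least (b : \bar R) :
   (forall r, Defs.lint_set (real_measure P) g r -> (r%:E <= b)%E) ->
   (\int[P]_x ereal_of_ext (g x) <= b)%E.
  move=> hb; rewrite ge0_integralTE //; apply: ge_ereal_sup => _ [h hg <-].
  by have [r -> /hb] := nnsfun_lint_set hg.
rewrite /Defs.lint /Defs.sup_ext.
case: ClassicalEpsilon.excluded_middle_informative => [hb|hb].
  case: Raxioms.completeness => s [sub slub] /=.
  suff -> : (\int[P]_x ereal_of_ext (g x) = s%:E)%E by [].
  apply/eqP; rewrite eq_le; apply/andP; split.
    by apply: least => r /sub /RleP; rewrite lee_fin.
  move: ub I0; case: (\int[P]_x _)%E => [i| |] ub I0; rewrite ?leey //.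
  rewrite lee_fin; apply/RleP/slub => r /ub; rewrite lee_fin => ?; exact/RleP.
move: ub I0 least; case: (\int[P]_x _)%E => [i|//|//] ub I0 _.
by case: hb; exists i => r /ub; rewrite lee_fin => ?; apply/RleP.
Qed.

Definition ext_shift (b : R) (v : Defs.ext) : Defs.ext := omap (fun r => r - b) v.

(** For a probability measure and an integrand at least [- b], the definition through positive and
    negative parts reduces to the nonnegative integrand [f + b], to which the theory of nonnegative
    functions applies. *)
Lemma integral_shift (f : R -> Defs.ext) (b : R) : 0 <= b ->
  (forall x, ((- b)%:E <= ereal_of_ext (f x))%E) ->
  measurable_fun [set: RM] (fun x : RM => ereal_of_ext (f x)) ->
  Defs.integral (real_measure P) f =
  ext_shift b (ext_of_ereal (\int[P]_x (ereal_of_ext (f x) + b%:E)%E)).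
Proof.
move=> b0 fb mf.
have posE x : ereal_of_ext (Defs.ext_pos f x) = maxe (ereal_of_ext (f x)) 0%E.
  rewrite /Defs.ext_pos; case: (f x) => [v|] /=; last by rewrite max_l // leey.
  by rewrite RmaxE EFin_max.
have negE x : ereal_of_ext (Defs.ext_neg f x) = maxe (- ereal_of_ext (f x))%E 0%E.
  rewrite /Defs.ext_neg; case: (f x) => [v|] /=; last by rewrite max_r.
  by rewrite RmaxE EFin_max.
have mpos : measurable_fun [set: RM] (fun x => ereal_of_ext (Defs.ext_pos f x)).
  by under eq_fun do rewrite posE; exact: measurable_maxe.
have mneg : measurable_fun [set: RM] (fun x => ereal_of_ext (Defs.ext_neg f x)).
  under eq_fun do rewrite negE; apply: measurable_maxe => //; exact: measurableT_comp.
have pos0 x : (0 <= ereal_of_ext (Defs.ext_pos f x))%E by rewrite posE le_max lexx orbT.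
have neg0 x : (0 <= ereal_of_ext (Defs.ext_neg f x))%E by rewrite negE le_max lexx orbT.
have fb0 x : (0 <= ereal_of_ext (f x) + b%:E)%E.
  by rewrite -[0%E](subee (_ : b%:E \is a fin_num)) // addeC leeD2r // fb.
have mfb : measurable_fun [set: RM] (fun x => ereal_of_ext (f x) + b%:E)%E.
  by apply: emeasurable_funD => //; exact: measurable_cst.
rewrite /Defs.integral !lint_integral //.
set IN := (\int[P]_x ereal_of_ext (Defs.ext_neg f x))%E.
set IP := (\int[P]_x ereal_of_ext (Defs.ext_pos f x))%E.
set IB := (\int[P]_x _)%E.
have IN0 : (0 <= IN)%E by apply: integral_ge0 => x _.
have IP0 : (0 <= IP)%E by apply: integral_ge0 => x _.
have Icst : (\int[P]_x (cst b%:E x) = b%:E)%E.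
  by rewrite integral_cst //= probability_setT mule1.
have INfin : (IN <= b%:E)%E.
  rewrite -Icst; apply: ge0_le_integral => // x _.
  by rewrite negE ge_max lee_fin b0 andbT leeNl fb.
(* The pointwise identity (f + b) + f^- = f^+ + b, integrated; the integral of f^- is at most [b],
   hence finite, and can be subtracted. *)
have bal : (IB + IN = IP + b%:E)%E.
  rewrite -Icst -!ge0_integralD //; try by move=> x _; rewrite lee_fin.
  apply: eq_integral => x _; rewrite posE negE /cst.
  case: (ereal_of_ext (f x)) (fb x) => [v|_|//] /=; last first.
    by rewrite max_r ?leNye // max_l ?leey // adde0.
  move=> _; rewrite -!EFin_max -!EFinD; congr (_%:E).
  by case: (leP (- v) 0) => ?; case: (leP v 0) => ?; lra.
move: IN0 INfin bal IP0; case: IN => [vn|//|//] _ _; case: IP => [vp| |//] /=.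
- case: IB => [v|//|//] /= [e] _; congr Some.
  by rewrite RminusE; lra.
- by case: IB.
Qed.

End Probability.

(** * Measurability of the weight *)

Lemma peval_measurable c : measurable_fun [set: RM] (Defs.peval c : RM -> R).
Proof.
elim: c => [|a c IH]; first exact: measurable_cst.
have -> : (Defs.peval (a :: c) : RM -> R) = (fun x : RM => (Rdefinitions.IZR a : R) + x * (Defs.peval c x : R)).
  by [].
by apply: measurable_funD => //; apply: measurable_funM.
Qed.

Lemma rpowE (x a : R) : Defs.rpow x a = if x == 0 then 0 else expR (a * ln x).
Proof.
rewrite /Defs.rpow; case: RIneq.Req_EM_T => [->|/eqP/negbTE ->]; first by rewrite eqxx.
by rewrite /Rpower.Rpower RexpE RlnE.
Qed.

Lemma rpow_measurable a : measurable_fun [set: RM] (Defs.rpow ^~ a : RM -> R).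
Proof.
have -> : (Defs.rpow ^~ a : RM -> R) = (fun x : RM => if (x : R) == 0 then 0 else expR (a * ln (x : R))).
  by apply/funext => x; rewrite rpowE.
apply: measurable_fun_ifT => //; first exact: measurable_fun_eqr.
apply: (measurableT_comp (@measurable_expR R)); apply: measurable_funM => //; exact: measurable_ln.
Qed.

Lemma prod_weight_measurable k Q al :
  measurable_fun [set: RM] (Defs.prod_weight k Q al : RM -> R).
Proof.
rewrite /Defs.prod_weight; elim: (List.seq 0 k) => [|i s IH] /=; first exact: measurable_cst.
have -> : (fun x : RM => Rdefinitions.RbaseSymbolsImpl.Rmult
    (Defs.rpow (Rbasic_fun.Rabs (Defs.peval (Q i) x)) (al i))
    (List.fold_right Rdefinitions.RbaseSymbolsImpl.Rmult (Rdefinitions.IZR (BinNums.Zpos BinNums.xH))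
      (List.map (fun i0 => Defs.rpow (Rbasic_fun.Rabs (Defs.peval (Q i0) x)) (al i0)) s))) =
  (fun x : RM => ((Defs.rpow ^~ (al i)) \o (fun x : RM => `|Defs.peval (Q i) x : R|)) x *
    (List.fold_right Rdefinitions.RbaseSymbolsImpl.Rmult (Rdefinitions.IZR (BinNums.Zpos BinNums.xH))
      (List.map (fun i0 => Defs.rpow (Rbasic_fun.Rabs (Defs.peval (Q i0) x)) (al i0)) s) : R)) :> (RM -> R).
  by apply/funext => x; rewrite /= RabsE.
apply: measurable_funM; last exact: IH.
apply: (measurableT_comp (rpow_measurable (al i))).
exact: (measurableT_comp (@normr_measurable R setT) (peval_measurable (Q i))).
Qed.

(** The first [K] terms give [K] times 2^-K, and the geometric tail gives 4 times 2^-K. *)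
Lemma dyadic_sum_le (F : realFieldType) K N :
  \sum_(0 <= k < N) (if (k < K)%N then 2^-1 ^+ K else 2 * 2^-1 ^+ k : F) <=
  2^-1 ^+ K * (K%:R + 4).
Proof.
set h : F := 2^-1 ^+ K.
have h0 : 0 < h by rewrite exprn_gt0 // invr_gt0.
(* [g N] is the tail of the full series from index [N], so partial sum plus tail stays constant. *)
pose g N : F := if (N <= K)%N then h * (K%:R - N%:R) + 4 * h else 4 * 2^-1 ^+ N.
have part : \sum_(0 <= k < N) (if (k < K)%N then h else 2 * 2^-1 ^+ k) + g N
    = h * (K%:R + 4).
  elim: N => [|N IH]; first by rewrite big_geq // add0r /g leq0n subr0; ring.
  rewrite -IH big_nat_recr //= -!addrA; congr (_ + _).
  rewrite /g; have [NK|KN|NK] := ltngtP N K.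
  - by rewrite -natr1; ring.
  - by rewrite exprS; field.
  - by rewrite NK subrr exprS /h; field.
have g0 : 0 <= g N.
  rewrite /g; case: ifP => [NK|_]; last by rewrite mulr_ge0 // exprn_ge0 // invr_ge0.
  by apply: addr_ge0; apply: mulr_ge0; rewrite ?(ltW h0) ?ler0n // subr_ge0 ler_nat.
by rewrite -part lerDl.
Qed.

Section Kernel.
Variable w : R -> R.

Definition kern (z t : R) : \bar R := ereal_of_ext (Defs.log_kernel 0 1 w z t).

Lemma kernE z t : kern z t =
  if (0 <= z <= 1) && (0 <= t <= 1) then
    if `|z - t| * w z * w t == 0 then +oo%E else (- ln (`|z - t| * w z * w t))%:E
  else 0%E.
Proof.
rewrite /kern /Defs.log_kernel.
case: ClassicalEpsilon.excluded_middle_informative => [[[/RleP-> /RleP->] [/RleP-> /RleP->]]|h] /=.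
  rewrite RabsE !RmultE RminusE.
  case: RIneq.Req_EM_T => [->|/eqP h]; first by rewrite eqxx.
  rewrite (negbTE h) /= RlnE RinvE; congr (_%:E).
  have [p0|p0] := ltP 0 (`|z - t| * w z * w t); first by rewrite lnV.
  by rewrite !ln0 ?oppr0 // invr_le0.
case: ifP => // /andP[/andP[z0 z1] /andP[t0 t1]]; case: h.
by split; split; apply/RleP.
Qed.

Hypothesis mw : measurable_fun [set: RM] (w : RM -> R).

Lemma kern_measurable : measurable_fun [set: RM * RM] (fun zt : RM * RM => kern zt.1 zt.2).
Proof.
under eq_fun do rewrite kernE.
have m1 : measurable_fun [set: RM * RM] (fun zt : RM * RM => zt.1 : R) by exact: measurable_fst.
have m2 : measurable_fun [set: RM * RM] (fun zt : RM * RM => zt.2 : R) by exact: measurable_snd.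
have mp : measurable_fun [set: RM * RM]
    (fun zt : RM * RM => `|(zt.1 : R) - (zt.2 : R)| * w zt.1 * w zt.2 : R).
  apply: measurable_funM; last exact: (measurableT_comp mw measurable_snd).
  apply: measurable_funM; last exact: (measurableT_comp mw measurable_fst).
  by apply: measurableT_comp => //; exact: measurable_funB.
apply: measurable_fun_ifT => //.
  by do !apply: measurable_and => //; apply: measurable_fun_ler => //; exact: measurable_cst.
apply: measurable_fun_ifT => //; first by apply: measurable_fun_eqr => //; exact: measurable_cst.
apply/measurable_EFinP; apply: measurableT_comp => //.
exact: (measurableT_comp (@measurable_ln R) mp).
Qed.

End Kernel.

(** * The average of uniform distributions on short intervals *)

Section Average.
Variables (n : nat) (a : nat -> R) (h : R).
Hypotheses (n0 : (0 < n)%N) (h0 : 0 < h).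

Let lt_a i : a i < a i + h. Proof. by rewrite ltrDl. Qed.

Let nV0 : 0 < n%:R^-1 :> R. Proof. by rewrite invr_gt0 ltr0n. Qed.

Definition avg_prob : set RM -> \bar R :=
  mscale (NngNum (ltW nV0)) (msum (fun i => uniform_prob (lt_a i)) n).

HB.instance Definition _ := Measure.on avg_prob.

Let avg_prob_setT : avg_prob setT = 1%E.
Proof.
rewrite /avg_prob /mscale /= /msum.
rewrite (eq_bigr (fun=> 1%E)) => [|i _]; last exact: probability_setT.
by rewrite sumEFin sumr_const card_ord -EFinM mulVf // pnatr_eq0 -lt0n.
Qed.

HB.instance Definition _ := @Measure_isProbability.Build _ _ R avg_prob avg_prob_setT.

Lemma integral_avg_prob (f : RM -> \bar R) :
  measurable_fun [set: RM] f -> (forall x, 0 <= f x)%E ->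
  (\int[avg_prob]_x f x =
   ((n%:R * h)^-1)%:E * \sum_(i < n) \int[lebesgue_measure]_(x in `[a i, (a i + h)%R]) f x)%E.
Proof.
move=> mf f0.
rewrite ge0_integral_mscale //= ge0_integral_measure_sum //.
rewrite (eq_bigr (fun i : 'I_n => (h^-1)%:E *
    \int[lebesgue_measure]_(x in `[a i, (a i + h)%R]) f x)%E); last first.
  by move=> i _; rewrite integral_uniform // (addrC (a i)) addrK.
rewrite -ge0_sume_distrr; last by move=> i _; exact: integral_ge0.
by rewrite muleA -EFinM invfM.
Qed.

End Average.

Lemma exists_average n (a : nat -> R) (h : R) : (0 < n)%N -> 0 < h ->
  exists P : probability RM R, forall f : RM -> \bar R,
  measurable_fun [set: RM] f -> (forall x, 0 <= f x)%E ->
  (\int[P]_x f x =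
   ((n%:R * h)^-1)%:E * \sum_(i < n) \int[lebesgue_measure]_(x in `[a i, (a i + h)%R]) f x)%E.
Proof. by move=> n0 h0; exists (avg_prob a n0 h0 : probability RM R); exact: integral_avg_prob. Qed.

(* [\sum_k 1_{|z - t| <= 2^-k}] dominates [- ln |z - t|] and has an explicit integral. *)
Definition dyadic_log (z t : R) : \bar R :=
  (\sum_(0 <= k <oo) (\1_(`[z - 2^-1 ^+ k, z + 2^-1 ^+ k]%classic) (t : RM) : R)%:E)%E.

Lemma dyadic_log_ge0 z t : (0 <= dyadic_log z t)%E.
Proof. by apply: nneseries_ge0 => k _ _; rewrite lee_fin. Qed.

Lemma dyadic_log_measurable z : measurable_fun [set: RM] (dyadic_log z : RM -> \bar R).
Proof.
apply: (@ge0_emeasurable_sum _ _ _ _ _ xpredT) => [k x _ _|k _]; first by rewrite lee_fin.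
by apply/measurable_EFinP; exact: measurable_indic.
Qed.

Lemma dyadic_log_partial z t m : `|z - t| <= 2^-1 ^+ m ->
  ((m.+1%:R)%:E <= dyadic_log z t)%E.
Proof.
move=> hm; apply: (@le_trans _ _ (\sum_(0 <= k < m.+1)
   (\1_(`[z - 2^-1 ^+ k, z + 2^-1 ^+ k]%classic) (t : RM) : R)%:E)%E); last first.
  by apply: nneseries_lim_ge => k _ _; rewrite lee_fin.
rewrite sumEFin lee_fin big_mkord (eq_bigr (fun=> 1)); last first.
  move=> [k km] _ /=; rewrite indicE mem_set //= in_itv /=.
  have : (2^-1 : R) ^+ m <= 2^-1 ^+ k by rewrite ler_wiXn2l // ?invr_ge0 // invf_le1 // ler1n.
  by move: hm; rewrite ler_norml; lra.
by rewrite sumr_const card_ord.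
Qed.

Lemma ln2_le1 : ln (2 : R) <= 1.
Proof. by have := @le_ln1Dx R 1; rewrite -[1 + 1]/(2%:R) => ->//; lra. Qed.

(** If [k + 1] is the first exponent with 2^-(k+1) < u, then - ln u <= (k+1) ln 2 <= k+1, and the
    intervals of exponents 0, ..., k all contain [t]. *)
Lemma ln_le_dyadic_log z t : `|z - t| <= 1 -> z != t ->
  ((- ln `|z - t|)%:E <= dyadic_log z t)%E.
Proof.
rewrite -subr_eq0 -normr_gt0; set u := `|z - t| => u1 u0.
have [m hm] : exists m, 2^-1 ^+ m < u.
  exists (Num.truncn u^-1).+1; rewrite exprVn -[ltRHS]invrK ltf_pV2 ?posrE ?exprn_gt0 ?invr_gt0 //.
  apply: lt_trans (truncnS_gt _) _.
  by rewrite -natrX ltr_nat ltn_expl.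
have ex : exists m, (2^-1 ^+ m < u) by exists m.
case: (ex_minnP ex) => -[|k] hk kmin; first by move: hk; rewrite expr0 ltNge u1.
have uk : u <= 2^-1 ^+ k.
  by rewrite leNgt; apply/negP => /kmin; rewrite ltnn.
apply: le_trans (dyadic_log_partial uk); rewrite lee_fin.
have : ln (2^-1 ^+ k.+1) <= ln u by rewrite ler_ln ?posrE ?exprn_gt0 ?invr_gt0 // ltW.
have -> : ln (2^-1 ^+ k.+1 : R) = - (k.+1%:R * ln 2).
  by rewrite exprVn lnV ?posrE ?exprn_gt0 // lnXn // mulr_natl.
have := ln2_le1; have : 0 <= (k.+1%:R : R) by [].
set l2 := ln 2; set lu := ln u; set kk := k.+1%:R; nra.
Qed.

(** Indicators with [k < K] are bounded by the length of the interval, the others by their own mass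
    2 * 2^-k. Relative to the length the bound is [K + 4], logarithmic in it and uniform in [z]. *)
Lemma integral_dyadic_log (z c : R) K : (\int[lebesgue_measure]_(t in `[c, (c + 2^-1 ^+ K)%R]) dyadic_log z t
  <= (2^-1 ^+ K * (K%:R + 4))%:E :> \bar R)%E.
Proof.
pose h : R := 2^-1 ^+ K.
have h0 : 0 < h by rewrite exprn_gt0 // invr_gt0.
rewrite /dyadic_log integral_nneseries //; try by move=> *; rewrite lee_fin.
  2: by move=> k; apply/measurable_EFinP; exact: measurable_indic.
pose f k : R := if (k < K)%N then h else 2 * 2^-1 ^+ k.
have bnd k : (\int[lebesgue_measure]_(t in `[c, (c + h)%R])
   (\1_(`[z - 2^-1 ^+ k, z + 2^-1 ^+ k]%classic) (t : RM) : R)%:E <= (f k)%:E)%E.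
  rewrite integral_indic // /f; case: ifP => _.
    apply: (@le_trans _ _ (lebesgue_measure (`[c, c + h]%classic : set RM))).
      by apply: le_measure; rewrite ?inE //; apply: measurableI.
    by rewrite lebesgue_measure_itv /= lte_fin ltrDl h0 -EFinB lee_fin; lra.
  have p0 : 0 < (2^-1 : R) ^+ k by rewrite exprn_gt0 // invr_gt0.
  apply: (@le_trans _ _ (lebesgue_measure (`[z - 2^-1 ^+ k, z + 2^-1 ^+ k]%classic : set RM))).
    by apply: le_measure; rewrite ?inE //; apply: measurableI.
  rewrite lebesgue_measure_itv /= lte_fin.
  have -> : z - 2^-1 ^+ k < z + 2^-1 ^+ k by lra.
  by rewrite -EFinB lee_fin; lra.
apply: lime_le; first by apply: is_cvg_nneseries => k _ _; apply: integral_ge0 => x _; rewrite lee_fin.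
near=> N; apply: (@le_trans _ _ (\sum_(0 <= k < N) (f k)%:E)%E).
  by apply: lee_sum => k _; exact: bnd.
by rewrite sumEFin lee_fin; exact: dyadic_sum_le.
Unshelve. all: by end_near. Qed.

(** * Energy of spread-out point charges *)

Section Energy.
Variables (w : R -> R) (b : R) (P : probability RM R).
Hypotheses (mw : measurable_fun [set: RM] (w : RM -> R)) (b0 : 0 <= b).
Hypothesis kb : forall z t, ((- b)%:E <= kern w z t)%E.

Definition potential (z : R) : \bar R := (\int[P]_t (kern w z t + b%:E))%E.

Lemma kern_shift_ge0 z t : (0 <= kern w z t + b%:E)%E.
Proof.
by rewrite -[0%E](subee (_ : b%:E \is a fin_num)) // addeC leeD2r // kb.
Qed.

Lemma kern_shift_measurable :
  measurable_fun [set: RM * RM] (fun zt : RM * RM => kern w zt.1 zt.2 + b%:E)%E.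
Proof. by apply: emeasurable_funD; [exact: kern_measurable|exact: measurable_cst]. Qed.

Lemma kern_section_measurable z :
  measurable_fun [set: RM] (fun t : RM => kern w z t).
Proof. exact: (measurableT_comp (kern_measurable mw) (measurable_pair1 (z : RM))). Qed.

Lemma potential_ge0 z : (0 <= potential z)%E.
Proof. by apply: integral_ge0 => t _; exact: kern_shift_ge0. Qed.

Lemma potential_measurable : measurable_fun [set: RM] (potential : RM -> \bar R).
Proof.
have := @measurable_fun_fubini_tonelli_F _ _ _ _ _ P _ kern_shift_measurable.
by apply => -[z t]; exact: kern_shift_ge0.
Qed.

(** Undoing the inner shift leaves an inner integral that is itself at least [- b], so
    [integral_shift] applies again to the outer one. *)
Lemma energyE : Defs.energy 0 1 w (real_measure P) =
  ext_shift b (ext_of_ereal (\int[P]_z potential z)).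
Proof.
have inner z : Defs.integral (real_measure P) (fun t => Defs.log_kernel 0 1 w z t) =
    ext_shift b (ext_of_ereal (potential z)).
  apply: integral_shift => //; first by move=> t; exact: kb.
  exact: kern_section_measurable.
have innerE z : ereal_of_ext (Defs.integral (real_measure P)
    (fun t => Defs.log_kernel 0 1 w z t)) = (potential z + (- b)%:E)%E.
  by rewrite inner; case: (potential z) (potential_ge0 z).
rewrite /Defs.energy (integral_shift P b0).
- congr (ext_shift _ (ext_of_ereal _)); apply: eq_integral => z _.
  by rewrite innerE -addeA -EFinD addNr adde0.
- move=> z; rewrite innerE; have := potential_ge0 z.
  case: (potential z) => [v v0|_|//]; last by rewrite /= leey.
  by rewrite -EFinD lee_fin lerDr -lee_fin.
- rewrite (_ : (fun x : RM => _) = (fun z : RM => potential z + (- b)%:E)%E); last first.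
    by apply/funext => z; rewrite innerE.
  by apply: emeasurable_funD; [exact: potential_measurable|exact: measurable_cst].
Qed.

End Energy.

(** For the average of the uniform measures on the intervals, each pair of intervals has mass 1/n^2;
    the singularity on the diagonal pairs adds [K + 4] for each of the [n] intervals. *)
Lemma energy_le (w : R -> R) (b : R) (n K : nat) (a : nat -> R) (kap : nat -> nat -> R) :
  measurable_fun [set: RM] (w : RM -> R) -> 0 <= b ->
  (forall z t, ((- b)%:E <= kern w z t)%E) -> (0 < n)%N ->
  let h := 2^-1 ^+ K : R in
  (forall i, (i < n)%N -> 0 <= a i /\ a i + h <= 1) ->
  (forall i j, (i < n)%N -> (j < n)%N -> 0 <= kap i j) ->
  (forall i j z t, (i < n)%N -> (j < n)%N ->
     a i <= z <= a i + h -> a j <= t <= a j + h ->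
     (kern w z t + b%:E <= (kap i j)%:E + if i == j then dyadic_log z t else 0)%E) ->
  exists2 v, Defs.energy_vals 0 1 w v &
   v <= (n%:R ^+ 2)^-1 * (\sum_(i < n) \sum_(j < n) kap i j + n%:R * (K%:R + 4)) - b.
Proof.
move=> mw b0 kb n0 h a01 kap0 hk.
have h0 : 0 < h by rewrite exprn_gt0 // invr_gt0.
have nR0 : 0 < n%:R :> R by rewrite ltr0n.
have [P PE] := exists_average a n0 h0.
pose I i : set RM := `[a i, a i + h]%classic.
have lI i : lebesgue_measure (I i) = h%:E.
  by rewrite lebesgue_measure_itv /= lte_fin ltrDl h0 -EFinB addrC addKr.
have mI i : measurable (I i) by exact: measurable_itv.
have cstI i (c : R) : (\int[lebesgue_measure]_(t in I i) (c%:E) = (c * h)%:E)%E.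
  by rewrite integral_cst // EFinM; congr (_ * _)%E; exact: lI.
have P01 : P (~` `[0, 1]%classic) = 0%E.
  have mC : measurable (~` `[0, 1]%classic : set RM) by apply: measurableC; exact: measurable_itv.
  rewrite -[LHS]/(P (~` `[0, 1]%classic)) -[X in P X]setIT -integral_indic // PE //; last first.
    by apply/measurable_EFinP; exact: measurable_indic.
  rewrite big1 ?mule0 // => i _; apply: integral0_eq => x /=; rewrite in_itv /= => /andP[ax xa].
  have [a0 a1] := a01 i (ltn_ord i).
  by rewrite indicE memNset //= in_itv /=; apply/negP/negPn; rewrite negbK; lra.
have potE z i : (i < n)%N -> I i z ->
   (potential w b P z <= (n%:R^-1 * (\sum_(j < n) kap i j + (K%:R + 4)))%:E)%E.
  move=> ni; rewrite /I /= in_itv /= => zI.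
  have mk : measurable_fun [set: RM] (fun t : RM => kern w z t + b%:E)%E.
    by apply: emeasurable_funD; [exact: kern_section_measurable|exact: measurable_cst].
  rewrite /potential PE //; last by move=> t; exact: kern_shift_ge0.
  apply: (@le_trans _ _ (((n%:R * h)^-1)%:E * \sum_(j < n)
     (h * (kap i j + (if i == j then K%:R + 4 else 0)))%:E)%E).
    rewrite lee_wpmul2l ?lee_fin ?invr_ge0 ?mulr_ge0 ?ler0n ?(ltW h0) //.
    apply: lee_sum => j _.
    apply: (@le_trans _ _ (\int[lebesgue_measure]_(t in I j)
       ((kap i j)%:E + if i == j then dyadic_log z t else 0))%E).
      apply: ge0_le_integral => //.
      - by move=> t _; exact: kern_shift_ge0.
      - exact: measurable_funTS.
      - apply: emeasurable_funD; first exact: measurable_cst.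
        case: (i == j :> nat); last exact: measurable_cst.
        by apply: measurable_funTS; exact: dyadic_log_measurable.
      - by move=> t; rewrite /I /= in_itv /= => tI; apply: hk.
    rewrite ge0_integralD //; last 3 first.
    - by move=> t _; rewrite lee_fin kap0.
    - by move=> t _; case: ifP => // _; exact: dyadic_log_ge0.
    - case: (i == j :> nat); last exact: measurable_cst.
      by apply: measurable_funTS; exact: dyadic_log_measurable.
    rewrite cstI mulrDr EFinD (mulrC h) leeD2l //.
    case: ifP => _; last by rewrite integral0 mulr0.
    exact: integral_dyadic_log.
  rewrite sumEFin -EFinM lee_fin -mulr_sumr big_split /=.
  rewrite [X in _ + X](_ : _ = K%:R + 4); last first.
    rewrite (bigD1 (Ordinal ni)) //= eqxx big1 ?addr0 // => j.
    by rewrite -val_eqE /= eq_sym => /negbTE->.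
  rewrite invfM mulrA -[X in X * _]mulrA mulVf ?mulr1 // gt_eqF //.
have mpot := potential_measurable P mw kb.
have EP : (\int[P]_z potential w b P z <=
   ((n%:R ^+ 2)^-1 * (\sum_(i < n) \sum_(j < n) kap i j + n%:R * (K%:R + 4)))%:E)%E.
  rewrite PE //; last by move=> t; exact: potential_ge0.
  apply: (@le_trans _ _ (((n%:R * h)^-1)%:E * \sum_(i < n)
     (h * (n%:R^-1 * (\sum_(j < n) kap i j + (K%:R + 4))))%:E)%E).
    rewrite lee_wpmul2l ?lee_fin ?invr_ge0 ?mulr_ge0 ?ler0n ?(ltW h0) //.
    apply: lee_sum => i _.
    apply: (@le_trans _ _ (\int[lebesgue_measure]_(t in I i)
       ((n%:R^-1 * (\sum_(j < n) kap i j + (K%:R + 4)))%:E))%E).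
      apply: ge0_le_integral => //.
      - by move=> t _; exact: potential_ge0.
      - exact: measurable_funTS.
      - by move=> t It; exact: potE.
    by rewrite cstI mulrC.
  rewrite sumEFin -EFinM lee_fin -!mulr_sumr big_split /= sumr_const card_ord.
  rewrite -(mulr_natl (K%:R + 4)) !mulrA invfM -(mulrA _ h^-1) mulVf ?mulr1 ?gt_eqF //.
  by rewrite expr2 invfM.
have I0 : (0 <= \int[P]_z potential w b P z)%E.
  by apply: integral_ge0 => z _; exact: potential_ge0.
have EE := energyE P mw b0 kb.
move: EE EP I0; case: (\int[P]_z _)%E => [v|//|//] EE EP I0.
exists (v - b); last by rewrite lerB // -lee_fin.
exists (real_measure P); split; last exact: EE.
exact: unit_measure_real_measure.
Qed.

(** The double sum of [u i + u j] is [2 n] times the sum of [u], which cancels the factor 1/(2n):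
    weights and distances recombine into the logarithm of the Fekete product. *)
Lemma energy_matrix_sum (F : realFieldType) n (b c : F) (lW u : nat -> F)
    (ld : nat -> nat -> F) :
  (0 < n)%N -> (forall i, u i = (2 * n%:R)^-1 * (- lW i + 2 + c)) ->
  \sum_(i < n) \sum_(j < n) (b + (if i == j :> nat then 0 else - ld i j + n%:R^-1) + (u i + u j))
  <= n%:R ^+ 2 * b - (\sum_(i < n) lW i + \sum_(i < n) \sum_(j < n | j != i :> nat) ld i j)
     + n%:R * (3 + c).
Proof.
move=> n0 uE; have nR : n%:R != 0 :> F by rewrite pnatr_eq0 -lt0n.
have su : \sum_(i < n) u i = (2 * n%:R)^-1 * (- \sum_(i < n) lW i + n%:R * (2 + c)).
  under eq_bigr do rewrite uE.
  rewrite -mulr_sumr; congr (_ * _).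
  under eq_bigr do rewrite -addrA.
  by rewrite big_split /= sumrN sumr_const card_ord -(mulr_natl (2 + c)).
apply: (@le_trans _ _ (\sum_(i < n) (n%:R * b - \sum_(j < n | j != i :> nat) ld i j
    + 1 + (n%:R * u i + \sum_(j < n) u j)))).
  apply: ler_sum => i _; rewrite !big_split /= !sumr_const !card_ord -(mulr_natl b) -(mulr_natl (u i)).
  rewrite lerD2r -addrA lerD2l -sumrN.
  rewrite [X in _ <= X + _]big_mkcond /=.
  rewrite [X in _ <= _ + X](_ : 1 = \sum_(j < n) n%:R^-1); last first.
    by rewrite sumr_const card_ord -(mulr_natl n%:R^-1) divff.
  rewrite -big_split; apply: ler_sum => j _ /=; rewrite (eq_sym (i : nat)).
  by case: eqP => _ //=; rewrite add0r invr_ge0.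
rewrite !big_split /= !sumr_const !card_ord -(mulr_natl (n%:R * b)) -(mulr_natl (\sum_(j < n) u j)) sumrN -mulr_sumr su.
rewrite le_eqVlt; apply/orP; left; apply/eqP; field.
by rewrite nR.
Qed.

Lemma energy_arith (F : realFieldType) (n v m f b c k S : F) : 1 <= n ->
  v <= (n ^+ 2)^-1 * (S + n * (k + 4)) - b ->
  S <= n ^+ 2 * b - f + n * (3 + c) -> m - 1 <= f ->
  n ^+ 2 * v <= - m + n * (c + k + 8).
Proof.
move=> n1 hv hS hf; have n2 : 0 < n ^+ 2 by rewrite exprn_gt0 //; lra.
have : n ^+ 2 * v <= (S + n * (k + 4)) - n ^+ 2 * b.
  rewrite -(ler_pM2l n2) in hv; apply: le_trans hv _.
  by rewrite mulrBr mulVKf // gt_eqF.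
nra.
Qed.

(** The interval has [x] as an endpoint and extends towards the farther end of [0, 1], so it stays
    inside. *)
Lemma interval_near (F : realFieldType) (x h : F) : 0 < h -> 2 * h <= 1 -> 0 <= x <= 1 ->
  let a := if x <= 2^-1 then x else x - h in
  (0 <= a /\ a + h <= 1) /\ forall s, a <= s <= a + h -> 0 <= s <= 1 /\ `|s - x| <= h.
Proof.
move=> h0 h1 x01 a; rewrite /a; case: (leP x 2^-1) => hx.
  by split; [split; lra|move=> s hs; split; [lra|rewrite ler_norml; lra]].
by split; [split; lra|move=> s hs; split; [lra|rewrite ler_norml; lra]].
Qed.

Lemma kern_lower_bound (w : R -> R) (B : R) : 1 <= B ->
  (forall t, 0 <= t <= 1 -> 0 <= w t <= B) ->
  forall z t, ((- (ln B + ln B))%:E <= kern w z t)%E.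
Proof.
move=> B1 wB z t; have B0 : 0 < B by apply: lt_le_trans B1.
have lB : 0 <= ln B by rewrite ln_ge0.
rewrite kernE; case: ifP => [/andP[z01 t01]|_]; last by rewrite lee_fin oppr_le0 addr_ge0.
case: eqP => [_|/eqP p0]; first by rewrite leey.
have /andP[wz wzB] := wB z z01; have /andP[wt wtB] := wB t t01.
move: (p0); rewrite !mulf_eq0 !negb_or => /andP[/andP[d0 wz0] wt0].
have {}d0 : 0 < `|z - t| by rewrite lt_neqAle eq_sym d0 normr_ge0.
have {}wz0 : 0 < w z by rewrite lt_neqAle eq_sym wz0.
have {}wt0 : 0 < w t by rewrite lt_neqAle eq_sym wt0.
rewrite lee_fin lerN2 -lnM ?posrE // ler_ln ?posrE ?mulr_gt0 //.
rewrite ler_pM ?mulr_ge0 // -[leRHS]mul1r ler_pM //.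
by rewrite ler_norml; move: z01 t01; lra.
Qed.

(** The kernel is infinite at [z = t], so the bound used on diagonal blocks has to be infinite there
    too. *)
Lemma dyadic_log_diag z : dyadic_log z z = +oo%E.
Proof.
have h m : ((m.+1%:R : R)%:E <= dyadic_log z z)%E.
  by apply: dyadic_log_partial; rewrite subrr normr0 exprn_ge0 // invr_ge0.
move: h (dyadic_log_ge0 z z); case: (dyadic_log z z) => [v|//|//] h v0.
have := h (Num.truncn v); rewrite lee_fin leNgt.
by rewrite truncnS_gt.
Qed.

(** The last hypothesis says that [W] is at most [expR c] times the power [2 n] of [w] wherever [W]
    is positive. *)
Lemma fekete_energy (w : R -> R) (B c : R) (W : {poly R}) (n N K : nat) :
  measurable_fun [set: RM] (w : RM -> R) -> 1 <= B ->
  (forall t, 0 <= t <= 1 -> 0 <= w t <= B) ->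
  (forall t, 0 <= W.[t]) -> (0 < n)%N -> (size W + n.*2 <= N.+1)%N ->
  let h := 2^-1 ^+ K : R in
  2 * h <= 1 -> 8 * (4 * N.+1%:R ^+ 3) * n%:R * h <= 1 ->
  0 < fekete_max W n ->
  (forall t, 0 <= t <= 1 -> 0 < W.[t] ->
     0 < w t /\ - ln (w t) <= (2 * n%:R)^-1 * (- ln W.[t] + c)) ->
  exists2 v, Defs.energy_vals 0 1 w v &
    n%:R ^+ 2 * v <= - ln (fekete_max W n) + n%:R * (c + K%:R + 8).
Proof.
move=> mw B1 wB W0 n0 sN h h2 hA m0 wW.
have h0 : 0 < h by rewrite exprn_gt0 // invr_gt0.
have [x hx Fx] : exists2 x, unit_points n x & fekete_max W n / 2 < fekete W n x.
  by apply: fekete_max_adherent => //; rewrite ltr_pdivrMr // ltr_pMr // ltr1n.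
pose b : R := ln B + ln B.
have b0 : 0 <= b by rewrite addr_ge0 // ln_ge0.
have kb := kern_lower_bound B1 wB.
pose a i : R := if x i <= 2^-1 then x i else x i - h.
have ha i : (i < n)%N -> (0 <= a i /\ a i + h <= 1) /\
    forall s, a i <= s <= a i + h -> 0 <= s <= 1 /\ `|s - x i| <= h.
  by move=> ni; apply: interval_near => //; exact: hx.
have W0i i : (i < n)%N -> 0 < W.[x i] by move=> ni; exact: (weight_gt0 W0 m0 Fx).
pose u i : R := (2 * n%:R)^-1 * (- ln W.[x i] + 2 + c).
have n2 : 0 <= (2 * n%:R : R)^-1 by rewrite invr_ge0 mulr_ge0.
have near i s : (i < n)%N -> a i <= s <= a i + h -> 0 < w s /\ - ln (w s) <= u i.
  move=> ni hs; have [s01 sx] := (ha i ni).2 s hs.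
  have [Ws lWs] := ln_weight_near W0 n0 sN h0 hA m0 hx Fx ni s01 sx.
  have [ws lws] := wW s s01 Ws; split=> //; apply: le_trans lws _.
  by rewrite ler_wpM2l // lerD2r.
(* Because [u i] is at least [- ln B], the shift [b = 2 ln B] makes the bounds [kap] nonnegative. *)
have ub i : (i < n)%N -> - ln B <= u i.
  move=> ni; have [wx lwx] := wW _ (hx i ni) (W0i i ni).
  apply: (@le_trans _ _ (- ln (w (x i)))).
    by rewrite lerN2 ler_ln ?posrE //; [exact: (andP (wB _ (hx i ni))).2|exact: lt_le_trans B1].
  by apply: le_trans lwx _; rewrite ler_wpM2l // lerD2r lerDl.
pose ld i j : R := ln `|x i - x j|.
pose kap i j : R := b + (if i == j then 0 else - ld i j + n%:R^-1) + (u i + u j).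
have dist1 i j : (i < n)%N -> (j < n)%N -> `|x i - x j| <= 1.
  by move=> ni nj; have := hx i ni; have := hx j nj; rewrite ler_norml; lra.
have [v vE hv] : exists2 v, Defs.energy_vals 0 1 w v &
   v <= (n%:R ^+ 2)^-1 * (\sum_(i < n) \sum_(j < n) kap i j + n%:R * (K%:R + 4)) - b.
  apply: (@energy_le w b n K a kap) => //.
  - by move=> i ni; have [] := ha i ni.
  - move=> i j ni nj; have := ub i ni; have := ub j nj; rewrite /kap /b.
    have : 0 <= (if i == j then 0 else - ld i j + n%:R^-1 : R).
      case: eqP => // _; rewrite addr_ge0 ?invr_ge0 // oppr_ge0 ln_le0 //.
      exact: dist1.
    by move: (ln B) (u i) (u j) (if i == j then _ else _) => p q r s; lra.
  - move=> i j z t ni nj zI tI.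
    have [wz lwz] := near i z ni zI; have [wt lwt] := near j t nj tI.
    have [z01 zx] := (ha i ni).2 z zI; have [t01 tx] := (ha j nj).2 t tI.
    rewrite kernE z01 t01 /= /kap.
    have split_ln : 0 < `|z - t| -> - ln (`|z - t| * w z * w t) = - ln `|z - t| - ln (w z) - ln (w t).
      by move=> d0; rewrite !lnM ?posrE ?mulr_gt0 // !opprD.
    case: (i =P j) => [ij|/eqP ij].
      subst i.
      have [->|zt] := eqVneq z t; first by rewrite dyadic_log_diag addey // leey.
      have d0 : 0 < `|z - t| by rewrite normr_gt0 subr_eq0.
      rewrite gt_eqF ?mulr_gt0 //.
      have zt1 : `|z - t| <= 1 by move: z01 t01; rewrite ler_norml; lra.
      have dl := ln_le_dyadic_log zt1 zt.
      apply: (@le_trans _ _ ((b + 0 + (u j + u j))%:E + (- ln `|z - t|)%:E)%E); last by rewrite leeD2l.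
      rewrite -!EFinD lee_fin split_ln //.
      move: lwz lwt.
      by rewrite addr0; move: (ln `|z - t|) (ln (w z)) (ln (w t)) (u j) => p q r s; lra.
    have [d0 dl] := ln_dist_near W0 n0 sN hA m0 hx Fx ni nj ij zx tx.
    rewrite gt_eqF ?mulr_gt0 // adde0 -EFinD lee_fin split_ln //.
    move: lwz lwt dl; rewrite /ld.
    by move: (ln `|z - t|) (ln (w z)) (ln (w t)) (u i) (u j) (ln `|x i - x j|) (n%:R^-1) => p q r s s' p' n'; lra.
exists v => //.
apply: (energy_arith _ hv (energy_matrix_sum b ld n0 (fun i => erefl (u i)))).
  by rewrite ler1n.
rewrite -(ln_fekete W0 sN m0 hx Fx).
exact: (ln_fekete_ge m0 Fx).
Qed.

(** * Polynomial weights *)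

From mathcomp Require Import ssrZ.

Lemma IZR_int_of_Z a : Rdefinitions.IZR a = (int_of_Z a)%:~R :> R.
Proof.
have pos p : Rdefinitions.IZR (BinNums.Zpos p) = (BinPos.Pos.to_nat p)%:R :> R.
  by rewrite -INRE RIneq.INR_IZR_INZ Znat.positive_nat_Z.
case: a => [|p|p] //=.
rewrite NegzE -/(BinInt.Z.opp (BinNums.Zpos p)) RIneq.opp_IZR RoppE pos.
have : (0 < BinPos.Pos.to_nat p)%N by lia.
by case: (BinPos.Pos.to_nat p) => // n _; rewrite rmorphN.
Qed.

Definition zpoly (c : seq BinNums.Z) : {poly int} := Poly (map int_of_Z c).

Lemma zpoly_cons a c : zpoly (a :: c) = zpoly c * 'X + (int_of_Z a)%:P.
Proof. by rewrite /zpoly /= cons_poly_def. Qed.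

Lemma horner_zpoly c (x : R) : (map_poly intr (zpoly c)).[x] = Defs.peval c x.
Proof.
elim: c => [|a c IH]; first by rewrite /zpoly /= rmorph0 horner0.
rewrite zpoly_cons rmorphD rmorphM /= map_polyX map_polyC /=.
by rewrite hornerD hornerMX hornerC IH RplusE RmultE IZR_int_of_Z addrC mulrC.
Qed.

Lemma zpoly_eq0 c a : zpoly c = 0 -> List.In a c -> a = BinNums.Z0.
Proof.
elim: c => [//|b c IH]; rewrite zpoly_cons => /polyP E [<-|].
  by have := E 0%N; rewrite coefD coefMX coefC coef0 /= add0r; lia.
apply: IH; apply/polyP => i; have := E i.+1.
by rewrite coefD coefMX coefC !coef0 /= addr0.
Qed.

Lemma zpoly_neq0 c : Defs.poly_nonzero c -> zpoly c != 0.
Proof. by move=> [a [ac a0]]; apply/eqP => /zpoly_eq0 /(_ ac). Qed.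

Lemma size_zpoly c d : Defs.poly_deg_le c d -> (size (zpoly c) <= d.+1)%N.
Proof.
move=> h; apply: leq_trans (size_Poly _) _; rewrite size_map.
exact/ssrnat.leP.
Qed.

Lemma size_prod_le (F : idomainType) k (f : nat -> {poly F}) (d : nat -> nat) :
  (forall i, (i < k)%N -> (size (f i) <= (d i).+1)%N) ->
  (size (\prod_(i < k) f i)%R <= (\sum_(i < k) d i).+1)%N.
Proof.
elim: k => [|k IH] h; first by rewrite !big_ord0 size_poly1.
rewrite !big_ord_recr /=; apply: leq_trans (size_polyMleq _ _) _.
have h1 := IH (fun i ik => h i (ltnW ik)); have h2 := h k (ltnSn k).
move: h1 h2; set u := size _; set v := size _; set s := (\sum_(i < k) _)%N; lia.
Qed.

Lemma prod_weightE k Q al (t : R) :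
  Defs.prod_weight k Q al t = \prod_(i < k) (Defs.rpow `|Defs.peval (Q i) t| (al i) : R).
Proof.
rewrite /Defs.prod_weight -(big_mkord xpredT (fun i => Defs.rpow `|Defs.peval (Q i) t| (al i) : R)).
suff H a : List.fold_right Rdefinitions.RbaseSymbolsImpl.Rmult
    (Rdefinitions.IZR (BinNums.Zpos BinNums.xH))
    (List.map (fun i => Defs.rpow (Rbasic_fun.Rabs (Defs.peval (Q i) t)) (al i)) (List.seq a k)) =
    \prod_(a <= i < a + k) (Defs.rpow `|Defs.peval (Q i) t| (al i) : R) by exact: H.
elim: k a => [|k IH] a /=; first by rewrite addn0 big_geq.
by rewrite IH RmultE RabsE addnS -addSn [RHS]big_ltn // ltnS leq_addr.
Qed.

Lemma alpha_sumE k m al : Defs.alpha_sum k m al = \sum_(i < k) (al i * (m i)%:R : R).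
Proof.
rewrite /Defs.alpha_sum fold_right_sum add0n big_mkord; apply: eq_bigr => i _.
by rewrite RmultE INRE.
Qed.

(** The excess of [e i] over [n * al i] lies in [0, 1], so an upper bound for [l i] controls its
    contribution even near the zeros of the polynomials, where [l i] is very negative. *)
Lemma weight_exponent_arith (F : realFieldType) k (n LB : F) (e al l : nat -> F) :
  0 < n -> 0 <= LB ->
  (forall i, (i < k)%N -> n * al i <= e i <= n * al i + 1) ->
  (forall i, (i < k)%N -> l i <= LB) ->
  - \sum_(i < k) al i * l i <=
  (2 * n)^-1 * (- \sum_(i < k) (2 * e i) * l i + 2 * (k%:R * LB)).
Proof.
move=> n0 LB0 he hl.
rewrite ler_pdivlMl ?mulr_gt0 //.
have -> : k%:R * LB = \sum_(i < k) LB by rewrite sumr_const card_ord mulr_natl.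
rewrite -!sumrN !mulr_sumr -big_split /=; apply: ler_sum => i _.
have /andP[h1 h2] := he i (ltn_ord i); have := hl i (ltn_ord i) => h3.
have : (e i - n * al i) * l i <= LB.
  apply: (@le_trans _ _ ((e i - n * al i) * LB)); first by rewrite ler_wpM2l // subr_ge0.
  by rewrite -[leRHS]mul1r ler_wpM2r //; lra.
lra.
Qed.

Lemma up_log2_le (F : realType) (M : nat) (T : F) : (1 < M)%N -> M%:R <= T ->
  (up_log 2 M)%:R <= 2 + 2 * ln T.
Proof.
move=> M1 MT.
have /andP[h1 _] := up_log_bounds (isT : (1 < 2)%N) M1.
have M0 : 0 < (M%:R : F) by rewrite ltr0n ltnW.
have T0 : 0 < T by exact: lt_le_trans MT.
have h2 : ln ((2 ^ (up_log 2 M).-1)%N%:R : F) <= ln T.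
  by rewrite ler_ln ?posrE ?ltr0n ?expn_gt0 // (le_trans _ MT) // ler_nat ltnW.
rewrite natrX lnXn // -(mulr_natl (ln 2)) in h2.
have l2 : 2^-1 <= ln (2 : F).
  rewrite -ler_expR lnK ?posrE // -[expR _]invrK -expRN -[leRHS]invrK lef_pV2 ?posrE ?invr_gt0 ?expR_gt0 //.
  by have := @expR_ge1Dx F (- 2^-1); lra.
have h3 : (up_log 2 M).-1%:R * 2^-1 <= (up_log 2 M).-1%:R * ln 2 :> F by rewrite ler_wpM2l.
have h4 : (up_log 2 M)%:R <= (up_log 2 M).-1%:R + 1 :> F.
  by rewrite natr1 ler_nat leqSpred.
lra.
Qed.

(** [N] is O(n), so [K] is the binary logarithm of a quantity of order n^4; this is the source of ln
    n in the error. *)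
Lemma log_budget (F : realType) (al c1 c : F) (n N K : nat) :
  0 <= al -> 0 <= c1 -> 0 <= c -> (0 < n)%N -> N%:R <= 2 * al * n%:R + c1 + 2 * n%:R ->
  K = up_log 2 (32 * N.+1 ^ 3 * n) ->
  n%:R * (c + K%:R + 8) <=
  (c + 18 + 2 * ln (32 * (2 * al + c1 + 3) ^+ 3)) * n%:R * (1 + ln n%:R).
Proof.
move=> al0 c10 c0 n0 hN ->.
set G := 2 * al + c1 + 3.
have n1 : 1 <= n%:R :> F by rewrite ler1n.
have nn0 : 0 < n%:R :> F by rewrite ltr0n.
have G1 : 1 <= G by rewrite /G; lra.
have G0 : 0 < G by lra.
have NG : N.+1%:R <= G * n%:R.
  have : c1 <= c1 * n%:R by rewrite ler_peMr.
  rewrite -natr1 /G; lra.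
have M1 : (1 < 32 * N.+1 ^ 3 * n)%N.
  by apply: (@leq_trans (32 * 1 * 1)) => //; rewrite !leq_mul // expn_gt0.
have MT : (32 * N.+1 ^ 3 * n)%N%:R <= 32 * G ^+ 3 * n%:R ^+ 4.
  rewrite natrM natrM natrX (_ : 32 * G ^+ 3 * n%:R ^+ 4 = 32 * (G * n%:R) ^+ 3 * n%:R); last by ring.
  by rewrite ler_pM2r // ler_pM2l // lerXn2r ?nnegrE // mulr_ge0 // ltW.
have := up_log2_le M1 MT.
have p32 : 0 < 32 * G ^+ 3 by rewrite mulr_gt0 // exprn_gt0.
rewrite lnM ?posrE ?exprn_gt0 // lnXn // -(mulr_natl (ln n%:R)).
have l0 : 0 <= ln (32 * G ^+ 3).
  rewrite ln_ge0 // -[leLHS]mul1r ler_pM // ?ler1n //.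
  by rewrite -(expr1n _ 3) lerXn2r ?nnegrE // ltW.
have ln0 : 0 <= ln (n%:R : F) by rewrite ln_ge0.
set LG := ln (32 * G ^+ 3) in l0 *; set Ln := ln n%:R in ln0 *; set U := (up_log _ _)%:R => hU.
rewrite -mulrA mulrCA ler_pM2l //.
have : 0 <= c * Ln by rewrite mulr_ge0.
have : 0 <= LG * Ln by rewrite mulr_ge0.
lra.
Qed.

Section Weighted.
Variables (k : nat) (m : nat -> nat) (Q : nat -> seq BinNums.Z) (al : nat -> R).
Hypothesis hQ : forall i, (i < k)%N ->
  [/\ Defs.poly_nonzero (Q i), Defs.poly_deg_le (Q i) (m i) & 0 < al i].

Local Notation w := (Defs.prod_weight k Q al).
Let alpha : R := \sum_(i < k) al i * (m i)%:R.

Lemma peval_bounded : exists2 BQ : R, 1 <= BQ &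
  forall i (t : R), (i < k)%N -> 0 <= t <= 1 -> `|Defs.peval (Q i) t : R| <= BQ.
Proof.
elim: (k) => [|k' [B B1 hB]]; first by exists 1.
have [b hb] := poly_itv_bound (map_poly (intr : int -> R) (zpoly (Q k'))) 0 1.
exists (Num.max B b); first by rewrite le_max B1.
move=> i t; rewrite ltnS leq_eqVlt => /orP[/eqP->|ik] t01; rewrite le_max.
  by rewrite -horner_zpoly hb // orbT.
by rewrite hB.
Qed.

(** The successor keeps the exponent positive, so the polynomial weight vanishes wherever some [Q i]
    does. *)
Definition exponent n i : nat := (Num.truncn (n%:R * al i)).+1.

Lemma exponent_bounds n i : (i < k)%N ->
  n%:R * al i <= (exponent n i)%:R <= n%:R * al i + 1.
Proof.
move=> ik; have [_ _ al0] := hQ ik; rewrite /exponent.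
have h : 0 <= n%:R * al i by rewrite mulr_ge0 // ltW.
by rewrite (ltW (truncnS_gt _)) /= -natr1 lerD2r truncn_le.
Qed.

Definition weight_poly n : {poly int} := \prod_(i < k) zpoly (Q i) ^+ exponent n i.

(** A degree bound formed with [m i] instead of the true degree, so that it grows like
    [2 * alpha * n]. *)
Definition weight_deg n : nat := (\sum_(i < k) 2 * exponent n i * m i)%N.

Lemma weight_poly_neq0 n : weight_poly n != 0.
Proof.
apply/prodf_neq0 => i _; have [Q0 _ _] := hQ (ltn_ord i).
by rewrite expf_neq0 // zpoly_neq0.
Qed.

Lemma size_weight_poly n : (size (weight_poly n ^+ 2) <= (weight_deg n).+1)%N.
Proof.
rewrite /weight_poly -prodrXl.
apply: (@size_prod_le _ k (fun i => (zpoly (Q i) ^+ exponent n i) ^+ 2)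
   (fun i => 2 * exponent n i * m i)%N) => i ik.
have [_ /size_zpoly sQ _] := hQ ik.
rewrite -exprM; apply: leq_trans (size_poly_exp_leq _ _) _; rewrite ltnS.
have : ((size (zpoly (Q i))).-1 <= m i)%N by move: sQ; set s := size _; lia.
move=> h; rewrite (mulnC 2) (mulnC _ (m i)).
exact: leq_mul.
Qed.

Lemma weight_deg_bounds n : 2 * alpha * n%:R <= (weight_deg n)%:R /\
  (weight_deg n)%:R <= 2 * alpha * n%:R + 2 * (\sum_(i < k) (m i)%:R : R).
Proof.
have term i : (i < k)%N -> 2 * (al i * (m i)%:R) * n%:R <= (2 * exponent n i * m i)%N%:R /\
    (2 * exponent n i * m i)%N%:R <= 2 * (al i * (m i)%:R) * n%:R + 2 * (m i)%:R.
  move=> ik; have /andP[h1 h2] := exponent_bounds n ik; rewrite !natrM.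
  have h3 := ler_wpM2r (ler0n R (m i)) h1; have h4 := ler_wpM2r (ler0n R (m i)) h2.
  move: h3 h4; rewrite mulrDl mul1r mulrA -!mulrA (mulrC (m i)%:R n%:R) (mulrCA (al i)).
  by move=> a b; split; [rewrite ler_pM2l|rewrite -mulrDr ler_pM2l].
rewrite /weight_deg natr_sum /alpha; split.
  rewrite mulr_sumr mulr_suml; apply: ler_sum => i _; exact: (term i (ltn_ord i)).1.
rewrite !mulr_sumr mulr_suml -big_split; apply: ler_sum => i _; exact: (term i (ltn_ord i)).2.
Qed.

Let q n : {poly R} := map_poly (intr : int -> R) (weight_poly n).

Lemma horner_weight n t : (q n ^+ 2).[t] = \prod_(i < k) `|Defs.peval (Q i) t : R| ^+ (2 * exponent n i).
Proof.
rewrite horner_exp /q /weight_poly rmorph_prod horner_prod -prodrXl; apply: eq_bigr => i _.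
by rewrite rmorphXn /= horner_exp horner_zpoly mulnC exprM -normrX real_normK ?num_real.
Qed.

Lemma weight_compare BQ n t : (0 < n)%N -> 1 <= BQ ->
  (forall i (t : R), (i < k)%N -> 0 <= t <= 1 -> `|Defs.peval (Q i) t : R| <= BQ) ->
  0 <= t <= 1 -> 0 < (q n ^+ 2).[t] ->
  0 < w t /\ - ln (w t) <= (2 * n%:R)^-1 * (- ln (q n ^+ 2).[t] + 2 * (k%:R * ln BQ)).
Proof.
move=> n0 BQ1 hB t01; rewrite horner_weight => W0.
pose l i : R := `|Defs.peval (Q i) t : R|.
have l0 i : (i < k)%N -> 0 < l i.
  move=> ik; rewrite lt_neqAle normr_ge0 andbT eq_sym; apply: contraTneq W0 => li.
  by rewrite (bigD1 (Ordinal ik)) //= -/(l i) li expr0n muln_eq0 /= mul0r ltxx.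
have wE : w t = \prod_(i < k) expR (al i * ln (l i)).
  rewrite prod_weightE; apply: eq_bigr => i _.
  by rewrite rpowE -/(l i) gt_eqF // l0.
rewrite wE; split; first by apply: prodr_gt0 => i _; exact: expR_gt0.
rewrite ln_prod; last by move=> i _; exact: expR_gt0.
rewrite ln_prod; last by move=> i _; rewrite exprn_gt0 // l0.
rewrite (eq_bigr (fun i : 'I_k => al i * ln (l i))); last by move=> i _; rewrite expRK.
rewrite [X in _ <= _ * (- X + _)](eq_bigr (fun i : 'I_k => (2 * (exponent n i)%:R) * ln (l i))); last first.
  by move=> i _; rewrite lnXn ?l0 // -[LHS]mulr_natl natrM.
apply: (@weight_exponent_arith _ k n%:R (ln BQ) (fun i => (exponent n i)%:R) al
  (fun i => ln (l i))).
- by rewrite ltr0n.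
- by rewrite ln_ge0.
- by move=> i ik; exact: exponent_bounds.
- move=> i ik; rewrite ler_ln ?posrE ?l0 //; last exact: lt_le_trans BQ1.
  exact: hB.
Qed.

Lemma weight_bounded BQ : 1 <= BQ ->
  (forall i (t : R), (i < k)%N -> 0 <= t <= 1 -> `|Defs.peval (Q i) t : R| <= BQ) ->
  exists2 B : R, 1 <= B & forall t, 0 <= t <= 1 -> 0 <= w t <= B.
Proof.
move=> BQ1 hB; have lB : 0 <= ln BQ by rewrite ln_ge0.
exists (\prod_(i < k) expR (al i * ln BQ)).
  elim/big_ind: _ => // [x y x1 y1|i _]; first by rewrite -[leLHS]mul1r ler_pM.
  have [_ _ al0] := hQ (ltn_ord i).
  by rewrite -[leLHS](@exp.expR0 R) ler_expR mulr_ge0 // ltW.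
move=> t t01; rewrite prod_weightE.
have h i : (i < k)%N -> 0 <= (Defs.rpow `|Defs.peval (Q i) t| (al i) : R) <= expR (al i * ln BQ).
  move=> ik; have [_ _ al0] := hQ ik; rewrite rpowE; case: eqP => [_|/eqP p0].
    by rewrite lexx expR_ge0.
  rewrite expR_ge0 ler_expR ler_pM2l // ler_ln ?posrE ?hB //.
    by rewrite lt_neqAle eq_sym p0 normr_ge0.
  exact: lt_le_trans BQ1.
rewrite prodr_ge0 /=; last by move=> i _; have /andP[] := h i (ltn_ord i).
by apply: ler_prod => i _; exact: h.
Qed.

(** The sum of psi(j) over j < N, that is, the integral of psi from 0 to N. *)
Definition lcm_log_sum (N : nat) : R := \sum_(0 <= j < N) ln (lcm_upto j)%:R.

Lemma psi_sum_lower_bound (V : R) : (forall v, Defs.energy_vals 0 1 w v -> V <= v) ->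
  exists c1 C : R, [/\ 0 <= c1, 0 <= C & forall n, (0 < n)%N -> exists D : nat,
    [/\ 2 * alpha * n%:R <= D%:R, D%:R <= 2 * alpha * n%:R + c1 &
     V * n%:R ^+ 2 - C * n%:R * (1 + ln n%:R) <= lcm_log_sum (2 * n + D) - lcm_log_sum (n + D)]].
Proof.
move=> hV; have [BQ BQ1 hBQ] := peval_bounded.
have [B B1 wB] := weight_bounded BQ1 hBQ.
have mw := prod_weight_measurable k Q al.
pose c : R := 2 * (k%:R * ln BQ).
have c0 : 0 <= c by rewrite mulr_ge0 // mulr_ge0 // ln_ge0.
pose c1 : R := 2 * (\sum_(i < k) (m i)%:R).
have c10 : 0 <= c1 by rewrite mulr_ge0 // sumr_ge0.
have al0 : 0 <= alpha.
  by apply: sumr_ge0 => i _; have [_ _ h] := hQ (ltn_ord i); rewrite mulr_ge0 // ltW.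
pose C := c + 18 + 2 * ln (32 * (2 * alpha + c1 + 3) ^+ 3).
have C0 : 0 <= C.
  rewrite /C addr_ge0 ?addr_ge0 // mulr_ge0 // ln_ge0 //.
  have G1 : 1 <= 2 * alpha + c1 + 3.
    by rewrite -[leLHS]add0r lerD ?ler1n // addr_ge0 // mulr_ge0.
  by rewrite -[leLHS]mul1r ler_pM ?ler1n // exprn_ege1.
exists c1, C; split=> // n n0; exists (weight_deg n).
have [D1 D2] := weight_deg_bounds n; split=> //.
set D := weight_deg n in D1 D2 *.
(* [N] bounds the degree of the Fekete product in one coordinate. [K] makes [h] satisfy
   [8 A n h <= 1] with the Markov constant [A = 4 (N + 1) ^ 3], whence the factor 32. *)
pose N := (D + n.*2)%N; pose K := up_log 2 (32 * N.+1 ^ 3 * n).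
have q0 : q n != 0 by rewrite map_poly_eq0_id0 ?weight_poly_neq0 // intr_eq0 lead_coef_eq0 weight_poly_neq0.
have W0 t : 0 <= (q n ^+ 2).[t] by rewrite horner_exp sqr_ge0.
have sq : (size (q n ^+ 2) <= D.+1)%N.
  rewrite /q -rmorphXn /=; apply: leq_trans (size_poly _ _) _; exact: size_weight_poly.
have sN : (size (q n ^+ 2) + n.*2 <= N.+1)%N.
  by rewrite /N -addSn leq_add2r.
have det := one_le_lcm_fekete R (weight_poly_neq0 n) (size_weight_poly n) lcm_upto_gt0 dvdn_lcm_upto n.
rewrite -/(q n) -/D in det.
have L0 : 0 < (\prod_(i < n) lcm_upto (n + D + i))%:R :> R.
  by rewrite ltr0n prodn_gt0 // => i; exact: lcm_upto_gt0.
have m0 : 0 < fekete_max (q n ^+ 2) n by rewrite -(pmulr_rgt0 _ L0); exact: lt_le_trans det.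
have M0 : (1 < 32 * N.+1 ^ 3 * n)%N.
  by apply: (@leq_trans (32 * 1 * 1)) => //; rewrite !leq_mul // expn_gt0.
have KM : (32 * N.+1 ^ 3 * n <= 2 ^ K)%N by exact: up_logP.
pose h : R := 2^-1 ^+ K.
have hE : h = ((2 ^ K)%N%:R)^-1 by rewrite /h exprVn natrX.
have K2 : 0 < (2 ^ K)%N%:R :> R by rewrite ltr0n expn_gt0.
have h2 : 2 * h <= 1.
  rewrite hE ler_pdivrMr // mul1r ler_nat; apply: leq_trans KM.
  by apply: (@leq_trans (32 * 1 * 1)) => //; rewrite !leq_mul // expn_gt0.
have hA : 8 * (4 * N.+1%:R ^+ 3) * n%:R * h <= 1.
  rewrite hE ler_pdivrMr // mul1r mulrA -natrM -natrX -!natrM ler_nat.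
  exact: KM.
have [v vE hv] := fekete_energy mw B1 wB W0 n0 sN h2 hA m0
  (fun t t01 Wt => weight_compare n0 BQ1 hBQ t01 Wt).
have Vv := hV v vE.
have lnm : - ln (fekete_max (q n ^+ 2) n) <= lcm_log_sum (2 * n + D) - lcm_log_sum (n + D).
  have := det; rewrite -ler_ln ?posrE // ?mulr_gt0 // ln1 lnM ?posrE // => hh.
  have -> : lcm_log_sum (2 * n + D) - lcm_log_sum (n + D) =
      ln (\prod_(i < n) lcm_upto (n + D + i))%:R.
    rewrite natr_prod ln_prod; last by move=> i _; rewrite ltr0n lcm_upto_gt0.
    rewrite /lcm_log_sum (@big_cat_nat _ _ _ (n + D)) //=; last by rewrite leq_add2r leq_pmull.
    rewrite addrAC subrr add0r -[X in \sum_(X <= _ < _) _]add0n big_addn big_mkord.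
    have -> : (2 * n + D - (n + D) = n)%N by rewrite mul2n -addnn -addnA addnK.
    by apply: eq_bigr => i _; rewrite addnC.
  by rewrite lerNl -subr_ge0 opprK addrC.
have hN : N%:R <= 2 * alpha * n%:R + c1 + 2 * n%:R.
  by rewrite /N natrD -mul2n natrM lerD2r.
have bud := log_budget al0 c10 c0 n0 hN (erefl K).
have nv : V * n%:R ^+ 2 <= n%:R ^+ 2 * v by rewrite mulrC ler_wpM2l // sqr_ge0.
rewrite lerBlDr; apply: le_trans nv _; apply: le_trans hv _.
by rewrite lerD.
Qed.

End Weighted.

(** Positivity rules out the two default branches of [weighted_cap], where the capacity is 0 and its
    logarithm is 0 by convention. *)
Lemma weighted_cap_le_energy (w : R -> R) :
  0 < - ln (Defs.weighted_cap 0 1 w : R) ->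
  forall v, Defs.energy_vals 0 1 w v -> - ln (Defs.weighted_cap 0 1 w : R) <= v.
Proof.
rewrite /Defs.weighted_cap.
case: ClassicalEpsilon.excluded_middle_informative => [hne|_]; last first.
  by rewrite ln0 // oppr0 ltxx.
case: ClassicalEpsilon.excluded_middle_informative => [hb|_]; last first.
  by rewrite ln0 // oppr0 ltxx.
case: Raxioms.completeness => s [ub _] /= _ v hv.
rewrite RexpE expRK lerNl; apply/RleP; apply: ub.
by rewrite RIneq.Ropp_involutive.
Qed.

Lemma lcm_log_sum_ge0 N : 0 <= lcm_log_sum N.
Proof. by apply: sumr_ge0 => i _; rewrite ln_ge0 // ler1n lcm_upto_gt0. Qed.

Lemma lcm_log_sum_mono m n : (m <= n)%N -> lcm_log_sum m <= lcm_log_sum n.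
Proof.
move=> mn; rewrite /lcm_log_sum (@big_cat_nat _ _ _ m 0 n) //= lerDl.
by apply: sumr_ge0 => i _; rewrite ln_ge0 // ler1n lcm_upto_gt0.
Qed.

Lemma RiemannInt_psi_ge (x : R) (N : nat) : N.+1%:R <= x < N.+2%:R ->
  exists pr : RiemannInt.Riemann_integrable Defs.psi 1 x,
    lcm_log_sum N.+1 <= RiemannInt.RiemannInt pr.
Proof.
move=> /andP[Nx xN].
have hf m y : Rdefinitions.Rle (Raxioms.INR m) y /\ Rdefinitions.Rlt y (Rdefinitions.Rplus (Raxioms.INR m) 1) ->
    Defs.psi y = ln ((lcm_upto m)%:R : R).
  rewrite INRE => -[/RleP my /RltP ym]; apply: psi_lcm.
  by rewrite my -natr1.
have g0 m : Rdefinitions.Rle 0 (ln ((lcm_upto m)%:R : R)).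
  by apply/RleP; rewrite ln_ge0 // ler1n lcm_upto_gt0.
have [|pr hpr] := @StepIntegral.RiemannInt_step_ge _ _ hf g0 x N.
  by rewrite INRE; split; [apply/RleP|apply/RltP; rewrite RplusE natr1].
move/RleP: hpr => hpr; exists pr; apply: le_trans hpr.
have -> : StepIntegral.step_sum (fun m => ln ((lcm_upto m)%:R : R)) N = lcm_log_sum N.+1; last by [].
elim: (N) => [|n IH] /=; last by rewrite IH /lcm_log_sum [RHS]big_nat_recr.
by rewrite /lcm_log_sum big_nat1 /lcm_upto big_mkcond big_nat1 /= ln1.
Qed.

Lemma psi_integral_lower_bound (k : nat) (m : nat -> nat) (Q : nat -> seq BinNums.Z) (al : nat -> R) :
  (forall i, (i < k)%N ->
    [/\ Defs.poly_nonzero (Q i), Defs.poly_deg_le (Q i) (m i) & 0 < al i]) ->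
  let V := - ln (Defs.weighted_cap 0 1 (Defs.prod_weight k Q al) : R) in
  let alpha := Defs.alpha_sum k m al : R in
  exists C : R, forall x : R, expR 1 <= x ->
    exists pr : RiemannInt.Riemann_integrable Defs.psi 1 x,
      V / (4 * alpha + 3) * x ^+ 2 - C * (x * ln x ^+ 2) <= RiemannInt.RiemannInt pr.
Proof.
move=> hQ V alpha.
have al0 : 0 <= alpha.
  rewrite /alpha alpha_sumE; apply: sumr_ge0 => i _.
  by have [_ _ h] := hQ i (ltn_ord i); rewrite mulr_ge0 // ltW.
have d0 : 0 < 4 * alpha + 3 by rewrite ltr_wpDl ?mulr_ge0.
have floorP (x : R) : expR 1 <= x -> exists N : nat, N.+1%:R <= x < N.+2%:R.
  move=> ex; have x1 : 1 <= x by apply: le_trans ex; rewrite -[leLHS](@exp.expR0 R) ler_expR.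
  exists (Num.truncn x).-1.
  have t1 : (0 < Num.truncn x)%N by rewrite truncn_gt0.
  by rewrite prednK // truncn_le ?(le_trans _ x1) // truncnS_gt.
(* For [V <= 0] the main term is nonpositive, and nonnegativity of the integral suffices with
   [C = 0]. *)
have [V0|V0] := leP V 0.
  exists 0 => x ex; have [N hN] := floorP x ex.
  have [pr hpr] := RiemannInt_psi_ge hN; exists pr; apply: le_trans hpr.
  apply: le_trans (lcm_log_sum_ge0 _); rewrite mul0r subr0.
  by rewrite mulr_le0_ge0 ?sqr_ge0 // mulr_le0_ge0 // invr_ge0 ltW.
have [c1 [C [c10 C0 step]]] := psi_sum_lower_bound hQ (weighted_cap_le_energy V0).
rewrite -alpha_sumE -/alpha in step.
have [A [B [A0 B0 hg]]] := growth lcm_log_sum_ge0 lcm_log_sum_mono (ltW V0) al0 c10 C0 step.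
exists (2 * (V / (4 * alpha + 3)) + 2 * A + B) => x ex; have [N hN] := floorP x ex.
have [pr hpr] := RiemannInt_psi_ge hN; exists pr; apply: le_trans hpr.
apply: le_trans (hg N).
have x0 : 0 < x by apply: lt_le_trans ex; exact: expR_gt0.
apply: growth_real => //; first by rewrite divr_ge0 // ltW.
by rewrite -ler_expR lnK ?posrE.
Qed.

From Stdlib Require Import Reals.
Local Open Scope R_scope.

Lemma psi_integral_lower_bound_R (k : nat) (m : nat -> nat) (Q : nat -> list Z)
    (al : nat -> Rdefinitions.R) :
  (forall i, (i < k)%coq_nat ->
     Defs.poly_nonzero (Q i) /\ Defs.poly_deg_le (Q i) (m i) /\ 0 < al i) ->
  exists C X0 : Rdefinitions.R, forall x : Rdefinitions.R, X0 <= x ->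
    exists pr : Riemann_integrable Defs.psi 1 x,
      RiemannInt pr >=
        (-2 * Rpower.ln (Defs.weighted_cap 0 1 (Defs.prod_weight k Q al))) /
          (4 * Defs.alpha_sum k m al + 3) * (x ^ 2 / 2)
        - C * (x * (Rpower.ln x) ^ 2).
Proof.
move=> hQ.
have [|C hC] := @psi_integral_lower_bound k m Q al.
  by move=> i /ssrnat.ltP /hQ [h1 [h2 /RltP h3]]; split.
have e3 : IZR 3 = (3%:R)%R by rewrite IZRposE INRE.
have e4 : IZR 4 = (4%:R)%R by rewrite IZRposE INRE.
(* The threshold e ensures ln x >= 1, as [growth_real] requires. *)
exists C, (Rtrigo_def.exp 1) => x /RleP; rewrite RexpE => ex.
have [pr hpr] := hC x ex; exists pr; apply: Rle_ge.
rewrite StepIntegral.bound_rearrange e3 e4 !RpowE !RlnE.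
exact/RleP.
Qed.

End ChebyshevBound.

Require Import Defs.
From Stdlib Require Import Reals ZArith List.
Open Scope R_scope.

Theorem theorem1p1 :
  forall (k : nat) (m : nat -> nat) (Q : nat -> list Z) (al : nat -> R),
    (1 <= k)%nat ->
    (forall i, (i < k)%nat ->
       poly_nonzero (Q i) /\ poly_deg_le (Q i) (m i) /\ 0 < al i) ->
    let w := prod_weight k Q al in
    let alpha := alpha_sum k m al in
    let cw := weighted_cap 0 1 w in
    exists C X0 : R, forall x : R, X0 <= x ->
      exists pr : Riemann_integrable psi 1 x,
        RiemannInt pr >= (-2 * ln cw) / (4 * alpha + 3) * (x ^ 2 / 2)
                         - C * (x * (ln x) ^ 2).
Proof.
intros k m Q al _ HQ w alpha cw.
exact (ChebyshevBound.psi_integral_lower_bound_R HQ).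
Qed.
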